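(* Let $\Omega\subseteq\mathbb{C}$ be a nonempty open connected subset. Let $X\neq\{0\}$ be a reflexive Banach space of analytic functions on $\Omega$ such that for each $\lambda\in\Omega$ the point evaluation $k_{\lambda}:X\rightarrow\mathbb{C}$, $k_{\lambda}(f)=f(\lambda)$ $(f\in X)$, is continuous on $X$. Suppose further that every bounded analytic function $\psi:\Omega\to\mathbb{C}$ defines a multiplication operator $M_{\psi}:X\rightarrow X$, $M_{\psi}(f)=\psi f$ $(f\in X)$ (in particular $\psi f\in X$ for all $f\in X$), with $\|M_{\psi}\|\leqslant\sup_{z\in\Omega}|\psi(z)|$. Let $\varphi$ be a nonconstant bounded analytic function on $\Omega$ and let $M_{\varphi}^{\ast}:X^{\ast}\to X^{\ast}$ be the conjugate of $M_{\varphi}$. Then the following assertions are equivalent: (1) $M_{\varphi}^{\ast}$ is hypercyclic; (2) $M_{\varphi}^{\ast}$ is mixing; (3) $M_{\varphi}^{\ast}$ is chaotic; (4) $\varphi(\Omega)\cap\mathbb{T}\neq\emptyset$.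
   Context: $\mathbb{N}$ denotes the set of nonnegative integers and $\mathbb{T}=\{z\in\mathbb{C}:|z|=1\}$. A Banach space of analytic functions on $\Omega$ is a complex vector space of analytic functions $\Omega\to\mathbb{C}$, with pointwise operations, equipped with a complete norm. $X^{\ast}$ is the space of continuous linear functionals on $X$ with the dual norm, and the conjugate (Banach space adjoint) of a continuous linear operator $T:X\to X$ is $T^{\ast}:X^{\ast}\to X^{\ast}$, $T^{\ast}(x^{\ast})=x^{\ast}\circ T$. A continuous linear operator $T$ on a Banach space $Y$ is called: - hypercyclic if there is $y\in Y$ whose orbit $\{T^{n}y:n\in\mathbb{N}\}$ is dense in $Y$; - topologically transitive if for any pair $U,V$ of nonempty open subsets of $Y$ there exists a nonnegative integer $n$ such that $T^{n}(U)\cap V\neq\emptyset$; - mixing if for any pair $U,V$ of nonempty open subsets of $Y$ there exists a nonnegative integer $N$ such that $T^{n}(U)\cap V\neq\emptyset$ for all $n\geqslant N$; - chaotic if $T$ is topologically transitive and has a dense set of periodic points (a point $y\in Y$ is periodic if $T^{n}y=y$ for some integer $n\geqslant 1$). Here these notions are applied to $M_{\varphi}^{\ast}$ on $Y=X^{\ast}$ with its norm topology. *)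

(* Defs.v *)
From HB Require Import structures.
From mathcomp Require Import all_boot all_order all_algebra.
From mathcomp Require Import complex.
From mathcomp Require Import all_classical all_reals all_analysis.

Set Implicit Arguments.
Unset Strict Implicit.
Unset Printing Implicit Defensive.

Import Order.TTheory GRing.Theory Num.Theory.
Import numFieldNormedType.Exports.

Local Open Scope classical_set_scope.
Local Open Scope complex_scope.
Local Open Scope ring_scope.

(* The norm of a normedModType over R[i] takes values in R[i] and is real
   there; suprema are taken in R, through complex.Re, and injected back.
   The field R[i], as a normed space over itself, is R[i]^o. *)

Section ContinuousLinear.
Variables (R : realType) (X Y : normedModType R[i]).

Definition clin_pred : {pred X -> Y} := fun f => `[< linear f /\ continuous f >].

Record clin := Clin { clin_val :> X -> Y; clinP : clin_val \in clin_pred }.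

HB.instance Definition _ := [isSub for clin_val].
HB.instance Definition _ := gen_eqMixin clin.
HB.instance Definition _ := gen_choiceMixin clin.

Lemma clin_pred_submod : GRing.subsemimod_closed clin_pred.
Proof.
have cst0 : (0 : X -> Y) \in clin_pred.
  apply/asboolP; split; first by move=> a x y /=; rewrite scaler0 addr0.
  exact: cst_continuous.
split; first split=> // f g /asboolP[lf cf] /asboolP[lg cg].
- apply/asboolP; split.
    by move=> a x y; rewrite /= !fctE lf lg scalerDr addrACA.
  by move=> x; apply: continuousD; [exact: cf|exact: cg].
move=> a f /asboolP[lf cf]; apply/asboolP; split.
  by move=> b x y; rewrite !fctE lf scalerDr !scalerA mulrC.
by move=> x; apply: continuousZr; exact: cf.
Qed.

HB.instance Definition _ :=
  GRing.isSubmodClosed.Build R[i] (X -> Y) clin_pred clin_pred_submod.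
HB.instance Definition _ := [SubChoice_isSubLmodule of clin by <:].

Lemma clin_linear (f : clin) : linear f.
Proof. by case: f => f /= /asboolP[]. Qed.

HB.instance Definition _ (f : clin) :=
  GRing.isLinear.Build R[i] X Y _ f (clin_linear f).

Lemma clin_continuous (f : clin) : continuous f.
Proof. by case: f => f /= /asboolP[]. Qed.

Lemma clin_ext (f g : clin) : (forall x, f x = g x) -> f = g.
Proof. by move=> fg; apply/val_inj/funext. Qed.

Definition opnorm (f : clin) : R[i] :=
  (sup [set complex.Re `|f x| | x in [set x : X | `|x| <= 1]])%:C.

Lemma norm_realE (V : normedModType R[i]) (x : V) : `|x| = (complex.Re `|x|)%:C.
Proof.
have := normr_ge0 x; rewrite lecE => /andP[/eqP/= i0 _].
by rewrite [LHS]complexE -/(complex.Re _) i0 mulr0 addr0.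
Qed.

Lemma Re_normE (V : normedModType R[i]) (x : V) (r : R) :
  (complex.Re `|x| <= r) = (`|x| <= r%:C).
Proof. by rewrite [in RHS]norm_realE lecR. Qed.

Lemma opnorm_has_sup (f : clin) :
  has_sup [set complex.Re `|f x| | x in [set x : X | `|x| <= 1]].
Proof.
split; first by exists (complex.Re `|f 0|), 0 => //=; rewrite normr0.
have /linear_boundedP := continuous_linear_bounded 0 (@clin_continuous f 0).
move=> /pinfty_ex_gt0[r r0 fr]; exists (complex.Re r) => _ [x /= x1 <-].
have rE : r = (complex.Re r)%:C.
  by rewrite -[LHS](ger0_norm (ltW r0)) (@norm_realE R[i]^o) ger0_norm// ltW.
rewrite Re_normE -rE (le_trans (fr x))//.
by rewrite -[leRHS]mulr1 ler_wpM2l// ltW.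
Qed.

Lemma opnorm_ge0 (f : clin) : 0 <= opnorm f.
Proof.
rewrite lecR; apply: le_trans (ub_le_sup (opnorm_has_sup f).2 _); last first.
  by exists 0 => //=; rewrite normr0.
by rewrite linear0 normr0.
Qed.

Lemma opnormP (f : clin) (x : X) : `|f x| <= opnorm f * `|x|.
Proof.
have [->|x0] := eqVneq x 0; first by rewrite linear0 !normr0 mulr0.
have nx0 : 0 < `|x| by rewrite normr_gt0.
have : `|f (`|x|^-1 *: x)| <= opnorm f.
  rewrite -Re_normE; apply: (ub_le_sup (opnorm_has_sup f).2).
  exists (`|x|^-1 *: x) => //=.
  by rewrite normrZ ger0_norm ?invr_ge0// mulVf// gt_eqF.
rewrite linearZ/= normrZ ger0_norm ?invr_ge0//.
by rewrite ler_pdivrMl// mulrC.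
Qed.

Lemma opnorm_le (f : clin) (c : R[i]) : 0 <= c ->
  (forall x, `|f x| <= c * `|x|) -> opnorm f <= c.
Proof.
move=> c0 fc; have cE : c = (complex.Re c)%:C.
  by rewrite -[LHS](ger0_norm c0) (@norm_realE R[i]^o) ger0_norm.
rewrite cE lecR; apply: ge_sup; first exact: (opnorm_has_sup f).1.
move=> _ [x /= x1 <-]; rewrite Re_normE -cE (le_trans (fc x))//.
by rewrite -[leRHS]mulr1 ler_wpM2l.
Qed.

Lemma opnormD (f g : clin) : opnorm (f + g) <= opnorm f + opnorm g.
Proof.
apply: opnorm_le => [|x]; first by rewrite addr_ge0 ?opnorm_ge0.
by rewrite mulrDl (le_trans (ler_normD _ _))// lerD ?opnormP.
Qed.

Lemma opnorm_eq0 (f : clin) : opnorm f = 0 -> f = 0.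
Proof.
move=> f0; apply: clin_ext => x; apply/eqP; rewrite -normr_le0.
by have := opnormP f x; rewrite f0 mul0r.
Qed.

Lemma opnormZ (l : R[i]) (f : clin) : opnorm (l *: f) = `|l| * opnorm f.
Proof.
have le_opnormZ a g : opnorm (a *: g) <= `|a| * opnorm g.
  apply: opnorm_le => [|x]; first by rewrite mulr_ge0 ?opnorm_ge0.
  by rewrite -mulrA normrZ ler_wpM2l ?opnormP.
apply/eqP; rewrite eq_le le_opnormZ /=.
have [->|l0] := eqVneq l 0; first by rewrite normr0 mul0r opnorm_ge0.
have := le_opnormZ l^-1 (l *: f); rewrite scalerA mulVf// scale1r normfV.
by rewrite ler_pdivlMl// normr_gt0.
Qed.

HB.instance Definition _ :=
  Lmodule_isNormed.Build R[i] clin opnormD opnormZ opnorm_eq0.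

End ContinuousLinear.

Definition dual (R : realType) (X : normedModType R[i]) : Type :=
  clin X R[i]^o.

HB.instance Definition _ (R : realType) (X : normedModType R[i]) :=
  NormedModule.copy (dual X) (clin X R[i]^o).

Section Adjoint.
Variables (R : realType) (X Y : normedModType R[i]) (T : clin X Y).

Lemma adjoint_fun_subproof (f : dual Y) :
  (f \o T : X -> R[i]^o) \in @clin_pred R X R[i]^o.
Proof.
apply/asboolP; split; first by move=> a x y /=; rewrite !linearP.
by move=> x; apply: continuous_comp; exact: clin_continuous.
Qed.

Definition adjoint_fun (f : dual Y) : dual X := Clin (adjoint_fun_subproof f).

Lemma adjoint_subproof : adjoint_fun \in @clin_pred R (dual Y) (dual X).
Proof.
have lin : linear adjoint_fun by move=> a f g; apply: clin_ext.
apply/asboolP; split=> //.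
pose A : {linear dual Y -> dual X} :=
  HB.pack adjoint_fun (GRing.isLinear.Build _ _ _ _ adjoint_fun lin).
apply: (@bounded_linear_continuous _ _ _ A); apply/linear_boundedP.
exists (opnorm T); split; first exact: ger0_real (opnorm_ge0 T).
move=> r Tr f; rewrite (@le_trans _ _ (opnorm T * `|f|))//; last first.
  by rewrite ler_wpM2r// ltW.
apply: opnorm_le => [|x]; first by rewrite mulr_ge0 ?opnorm_ge0.
rewrite mulrAC (le_trans (opnormP f (T x)))// mulrC ler_wpM2r ?opnorm_ge0//.
exact: opnormP.
Qed.

Definition adjoint : clin (dual Y) (dual X) := Clin adjoint_subproof.

End Adjoint.

Definition reflexive_space (R : realType) (X : normedModType R[i]) : Prop :=
  forall F : dual (dual X), exists x : X, forall f : dual X, F f = f x.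

Section Dynamics.
Variables (Y : topologicalType) (T : Y -> Y).

Definition hypercyclic : Prop :=
  exists y, dense [set iter n T y | n in [set: nat]].

Definition topologically_transitive : Prop :=
  forall U V : set Y, open U -> open V -> U !=set0 -> V !=set0 ->
  exists n, (iter n T @` U) `&` V !=set0.

Definition mixing : Prop :=
  forall U V : set Y, open U -> open V -> U !=set0 -> V !=set0 ->
  exists N, forall n, (N <= n)%N -> (iter n T @` U) `&` V !=set0.

Definition periodic_point (y : Y) : Prop :=
  exists n, (1 <= n)%N /\ iter n T y = y.

Definition chaotic : Prop :=
  topologically_transitive /\ dense [set y | periodic_point y].

End Dynamics.

Section AnalyticFunctions.
Variables (R : realType) (Omega : set R[i]^o).

(* A function on Omega is represented by a total function; only its values on
   Omega are ever used.  Analytic means locally the sum of a power series. *)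
Definition analytic_on (f : R[i]^o -> R[i]^o) : Prop :=
  forall z, Omega z -> exists a : nat -> R[i]^o,
    \forall w \near z, [series a k * (w - z) ^+ k]_k @ \oo --> f w.

Definition bounded_analytic_on (f : R[i]^o -> R[i]^o) : Prop :=
  analytic_on f /\ [bounded f z | z in Omega].

Definition supnorm (f : R[i]^o -> R[i]^o) : R[i] :=
  (sup [set complex.Re `|f z| | z in Omega])%:C.

(* Elements of X are identified with functions on Omega through the injection
   ev, which carries the operations of X to the pointwise ones. *)
Record banach_space_of_analytic_functions (X : completeNormedModType R[i])
    (ev : X -> R[i]^o -> R[i]^o) : Prop := BanachSpaceOfAnalyticFunctions {
  ev_linear : forall (a : R[i]) (f g : X) z, Omega z ->
    ev (a *: f + g) z = a * ev f z + ev g z;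
  ev_injective : forall f g : X, (forall z, Omega z -> ev f z = ev g z) -> f = g;
  ev_analytic : forall f : X, analytic_on (ev f)
}.

Definition is_multiplication_operator (X : completeNormedModType R[i])
    (ev : X -> R[i]^o -> R[i]^o) (psi : R[i]^o -> R[i]^o) (M : X -> X) : Prop :=
  forall f z, Omega z -> ev (M f) z = psi z * ev f z.

End AnalyticFunctions.

(* Main.v *)
(* Write T for the adjoint of M_phi and k_z for the evaluation at z, so that
   T k_z = phi(z) k_z.  By Hahn-Banach and reflexivity, {k_z : z in A} spans a
   dense subspace of X^* as soon as no nonzero f in X vanishes on A, and by the
   identity theorem this holds when A clusters at a point of Omega.
   If |phi(z0)| = 1, the sets {|phi| < 1} and {|phi| > 1} cluster at z0 because
   phi is locally c + b h^m + O(h^(m+1)), and {phi is a root of unity} does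
   because phi is open.  These three sets yield dense subspaces of vectors with
   vanishing forward orbit, of vectors with vanishing backward orbit, and of
   periodic points; hence T is mixing and chaotic, and it is hypercyclic by
   Birkhoff's nested ball argument, the evaluations at rational points making
   X^* separable.
   If phi(Omega) misses the unit circle, connectedness gives |phi| < 1 or
   |phi| > 1 on all of Omega; the norm bound on multiplication operators, applied
   to phi or to 1/phi, shows that T is nonexpansive or that it decreases no norm.
   The open mapping property and the analyticity of 1/phi are read off the local
   power series directly, without Cauchy's integral formula. *)

Require Import Defs.
From HB Require Import structures.
From mathcomp Require Import all_boot all_order all_algebra.
From mathcomp Require Import complex.
From mathcomp Require Import all_classical all_reals all_analysis.
From mathcomp Require Import ring lra.

Set Implicit Arguments.
Unset Strict Implicit.
Unset Printing Implicit Defensive.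

Import Order.TTheory GRing.Theory Num.Theory.
Import numFieldNormedType.Exports.

Local Open Scope classical_set_scope.
Local Open Scope ring_scope.
Local Open Scope complex_scope.

(** * Real-valued norms *)

(* Norms over [R[i]] are real but live in [R[i]], where [lra] is unavailable;
   [nm] and, for scalars, [cm] read them in [R]. *)
Definition nm {R : realType} {V : normedModType R[i]} (x : V) : R :=
  complex.Re `|x|.

Definition cm {R : realType} (x : R[i]) : R := complex.Re `|x|.

Section RealNorm.
Variables (R : realType) (V : normedModType R[i]).
Implicit Types (x y : V) (a : R[i]).

Lemma cmE a : `|a| = (cm a)%:C.
Proof. exact: (@norm_realE R R[i]^o). Qed.

Lemma nmE x : `|x| = (nm x)%:C.
Proof. exact: norm_realE. Qed.

Lemma nm_cm (a : R[i]^o) : nm a = cm a.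
Proof. by []. Qed.

Lemma nm_le x (r : R) : (`|x| <= r%:C) = (nm x <= r).
Proof. by rewrite nmE lecR. Qed.

Lemma nm_lt x (r : R) : (`|x| < r%:C) = (nm x < r).
Proof. by rewrite nmE ltcR. Qed.

Lemma nm_ge0 x : 0 <= nm x.
Proof. by rewrite -lecR -nmE normr_ge0. Qed.

Lemma nm0 : nm (0 : V) = 0.
Proof. by rewrite /nm normr0. Qed.

Lemma nm_eq0 x : (nm x == 0) = (x == 0).
Proof. by rewrite -(inj_eq (@complexI R)) -nmE normr_eq0. Qed.

Lemma nm_gt0 x : (0 < nm x) = (x != 0).
Proof. by rewrite lt_def nm_ge0 andbT nm_eq0. Qed.

Lemma nmD x y : nm (x + y) <= nm x + nm y.
Proof. by rewrite -lecR rmorphD/= -!nmE ler_normD. Qed.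

Lemma nmN x : nm (- x) = nm x.
Proof. by rewrite /nm normrN. Qed.

Lemma nmB x y : nm (x - y) <= nm x + nm y.
Proof. by rewrite -[nm y]nmN nmD. Qed.

Lemma nmC x y : nm (x - y) = nm (y - x).
Proof. by rewrite -nmN opprB. Qed.

Lemma nmZ a x : nm (a *: x) = cm a * nm x.
Proof. by apply: (@complexI R); rewrite rmorphM/= -nmE -cmE -nmE normrZ. Qed.

Lemma nm_trans y x z : nm (x - z) <= nm (x - y) + nm (y - z).
Proof. by apply: le_trans (nmD _ _); rewrite addrA subrK. Qed.

(** Positive elements of [R[i]] are real in its order, so every radius can be taken in [R]. *)
Lemma gt0_real (e : R[i]) : 0 < e -> exists2 r : R, 0 < r & e = r%:C.
Proof.
move=> e0; exists (cm e).
  by rewrite -ltcR -cmE normr_gt0 gt_eqF.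
by rewrite -cmE gtr0_norm.
Qed.

Lemma near_nmP x (P : set V) :
  (\forall y \near x, P y) <->
  exists2 d : R, 0 < d & forall y, nm (y - x) < d -> P y.
Proof.
split=> [/nbhs_normP[e /= /gt0_real[r r0 ->] H]|[d d0 H]].
  by exists r => // y yr; apply: H; rewrite /ball_/= nm_lt nmC.
apply/nbhs_normP; exists d%:C => /=; first by rewrite ltcR.
by move=> y; rewrite /ball_/= nm_lt nmC; exact: H.
Qed.

Lemma open_nmP (U : set V) : open U ->
  forall x, U x -> exists2 d : R, 0 < d & forall y, nm (y - x) < d -> U y.
Proof. by move=> oU x Ux; apply/near_nmP; exact: open_nbhs_nbhs. Qed.

Lemma nm_open (U : set V) : (forall x, U x ->
  exists2 d : R, 0 < d & forall y, nm (y - x) < d -> U y) -> open U.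
Proof. by rewrite openE => H x /H; rewrite -near_nmP. Qed.

Lemma nm_ball_open x (r : R) : open [set y | nm (y - x) < r].
Proof.
apply: nm_open => y /= yr; exists (r - nm (y - x)); first by rewrite subr_gt0.
by move=> z zr; rewrite (le_lt_trans (nm_trans y _ _))// -ltrBrDr.
Qed.

Lemma dense_nmP (D : set V) : dense D <->
  forall x (e : R), 0 < e -> exists2 y, D y & nm (y - x) < e.
Proof.
split=> [dD x e e0|dD U [x Ux] oU].
  have [||y [/= ye Dy]] := dD [set y | nm (y - x) < e].
  - by exists x; rewrite /= subrr nm0.
  - exact: nm_ball_open.
  by exists y.
have [d d0 dU] := open_nmP oU Ux.
have [y Dy yd] := dD x d d0.
by exists y; split=> //; exact: dU.
Qed.

End RealNorm.

Section ScalarNorm.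
Variable R : realType.
Implicit Types (a b : R[i]).

Lemma cm_ge0 a : 0 <= cm a. Proof. exact: (@nm_ge0 R R[i]^o). Qed.
Lemma cm0 : cm (0 : R[i]) = 0. Proof. exact: (@nm0 R R[i]^o). Qed.
Lemma cm_eq0 a : (cm a == 0) = (a == 0).
Proof. exact: (@nm_eq0 R R[i]^o). Qed.
Lemma cm_gt0 a : (0 < cm a) = (a != 0).
Proof. exact: (@nm_gt0 R R[i]^o). Qed.
Lemma cmD a b : cm (a + b) <= cm a + cm b.
Proof. exact: (@nmD R R[i]^o). Qed.
Lemma cmN a : cm (- a) = cm a. Proof. exact: (@nmN R R[i]^o). Qed.
Lemma cmB a b : cm (a - b) <= cm a + cm b.
Proof. exact: (@nmB R R[i]^o). Qed.
Lemma cmC a b : cm (a - b) = cm (b - a). Proof. exact: (@nmC R R[i]^o). Qed.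
Lemma cmM a b : cm (a * b) = cm a * cm b.
Proof. exact: (@nmZ R R[i]^o). Qed.
Lemma cm_trans b a c : cm (a - c) <= cm (a - b) + cm (b - c).
Proof. exact: (@nm_trans R R[i]^o). Qed.
Lemma cm1 : cm (1 : R[i]) = 1. Proof. by rewrite /cm normr1. Qed.
Lemma cmX a n : cm (a ^+ n) = cm a ^+ n.
Proof. by elim: n => [|n IH]; rewrite ?expr0 ?cm1// !exprS cmM IH. Qed.
Lemma cmV a : cm (a^-1) = (cm a)^-1.
Proof. by apply: (@complexI R); rewrite -cmE normfV cmE fmorphV. Qed.
Lemma cm_real (r : R) : cm r%:C = `|r|.
Proof. by rewrite /cm normc_def/= expr0n/= addr0 sqrtr_sqr. Qed.
Lemma cm_sum (I : Type) (s : seq I) (P : pred I) (F : I -> R[i]) :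
  cm (\sum_(i <- s | P i) F i) <= \sum_(i <- s | P i) cm (F i).
Proof.
elim/big_rec2: _ => [|i y x _ IH]; first by rewrite cm0.
by rewrite (le_trans (cmD _ _))// lerD2l.
Qed.
Lemma cm_Re a : `|complex.Re a| <= cm a.
Proof. by rewrite -lecR -cmE normc_ge_Re. Qed.
Lemma cm_Im a : `|complex.Im a| <= cm a.
Proof.
rewrite /cm normc_def/= -[leLHS]sqrtr_sqr ler_wsqrtr// lerDr sqr_ge0 //.
Qed.
Lemma cm_ReIm a : cm a <= `|complex.Re a| + `|complex.Im a|.
Proof.
rewrite [a in leLHS]complexE (le_trans (cmD _ _))// cmM !cm_real lerD2l.
by rewrite /cm normc_def/= expr0n/= add0r expr1n sqrtr1 mul1r.
Qed.
Lemma cm_sqr a : cm a ^+ 2 = complex.Re a ^+ 2 + complex.Im a ^+ 2.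
Proof. by apply: (@complexI R); rewrite add_Re2_Im2 cmE rmorphXn. Qed.

(** Unfolds the limit into real inequalities, with the displacement [h] from [z] as the variable. *)
Lemma analytic_onP (Om : set R[i]^o) (f : R[i]^o -> R[i]^o) :
  analytic_on Om f <-> forall z : R[i], Om z -> exists (a : nat -> R[i]) (d : R),
    0 < d /\ forall h : R[i], cm h < d -> forall e : R, 0 < e ->
     exists N, forall n, (N <= n)%N ->
     cm (f (z + h) - \sum_(0 <= k < n) a k * h ^+ k) < e.
Proof.
split=> Hf z Omz.
  have [a /near_nmP[d d0 H]] := Hf z Omz.
  exists a, d; split=> // h hd e e0.
  have := H (z + h); rewrite (addrC z h) addrK nm_cm => /(_ hd).
  move=> /cvgrPdist_lt/(_ e%:C); rewrite ltcR => /(_ e0)[N _ HN].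
  by exists N => n /HN; rewrite /= nm_lt.
have [a [d [d0 H]]] := Hf z Omz.
exists a; apply/near_nmP; exists d => // w wd.
apply/cvgrPdist_lt => _ /gt0_real[e e0 ->].
have [N HN] := H (w - z) wd e e0.
by exists N => // n /= /HN; rewrite nm_lt [z + _]addrC subrK.
Qed.

End ScalarNorm.

(** * Local behaviour of a power series *)

Section LocalExpansion.
Variable R : realType.
Implicit Types (a : nat -> R[i]) (f : R[i] -> R[i]) (z h : R[i]).

Definition expansion f z a (d : R) : Prop :=
  forall h, cm h < d -> forall e : R, 0 < e -> exists N, forall n, (N <= n)%N ->
    cm (f (z + h) - \sum_(0 <= k < n) a k * h ^+ k) < e.

(** The subtracted term is what lets the induction on [m] close. *)
Lemma geom_sum_le (x : R) p m : 0 <= x -> x <= 1 / 2 ->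
  \sum_(p <= k < p + m) x ^+ k <= 2 * x ^+ p - 2 * x ^+ (p + m).
Proof.
move=> x0 x1; elim: m => [|m IH]; first by rewrite addn0 big_geq// subrr.
rewrite addnS big_nat_recr ?leq_addr//= exprS.
have : 0 <= x ^+ (p + m) by rewrite exprn_ge0.
nra.
Qed.

Lemma series_tail_le a (M K : R) h p n :
  (forall k, cm (a k) <= M * K ^+ k) -> 0 <= M -> 0 <= K ->
  K * cm h <= 1 / 2 ->
  cm (\sum_(p <= k < n) a k * h ^+ k) <= 2 * M * (K * cm h) ^+ p.
Proof.
move=> aM M0 K0 Kh; have x0 : 0 <= K * cm h by rewrite mulr_ge0 ?cm_ge0.
have [np|pn] := leqP n p.
  by rewrite big_geq// cm0 !mulr_ge0// exprn_ge0.
rewrite (le_trans (cm_sum _ _ _))//.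
apply: (@le_trans _ _ (\sum_(p <= k < n) M * (K * cm h) ^+ k)).
  apply: ler_sum => k _; rewrite cmM cmX exprMn mulrA ler_wpM2r//.
  by rewrite exprn_ge0 ?cm_ge0.
rewrite -mulr_sumr -(subnKC (ltnW pn)).
have := geom_sum_le p (n - p) x0 Kh.
have : 0 <= (K * cm h) ^+ (p + (n - p)) by rewrite exprn_ge0.
nra.
Qed.

Lemma cm_lim_le (y c : R[i]) (S : nat -> R[i]) (B : R) :
  (forall e : R, 0 < e -> exists N, forall n, (N <= n)%N -> cm (y - S n) < e) ->
  (exists N, forall n, (N <= n)%N -> cm (S n - c) <= B) -> cm (y - c) <= B.
Proof.
move=> Sy [N HN]; apply/ler_addgt0Pr => e e0; have [M HM] := Sy e e0.
rewrite (le_trans (cm_trans (S (maxn M N)) _ _))// addrC lerD//.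
  by rewrite HN ?leq_maxr.
by rewrite ltW// HM ?leq_maxl.
Qed.

Lemma expansion_coef0 f z a d : 0 < d -> expansion f z a d -> f z = a 0%N.
Proof.
move=> d0 fa; apply/eqP; rewrite -subr_eq0 -cm_eq0 eq_le cm_ge0 andbT.
apply: (cm_lim_le (S := fun n => \sum_(0 <= k < n) a k * 0 ^+ k)).
  by move=> e e0; have := fa 0; rewrite cm0 addr0; exact.
exists 1%N => -[//|n] _; rewrite big_nat_recl// expr0 mulr1.
rewrite big1 ?addr0 ?subrr ?cm0// => k _.
by rewrite expr0n mulr0.
Qed.

(** At the radius [d / 2] the terms are differences of consecutive partial sums. From some [N] on
    these sums are within 1 of [f (z + h)], so the terms are at most 2. *)
Lemma expansion_coef_le f z a d : 0 < d -> expansion f z a d ->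
  exists M K : R, [/\ 0 <= M, 0 < K & forall k, cm (a k) <= M * K ^+ k].
Proof.
move=> d0 fa; pose h : R[i] := (d / 2)%:C.
have h0 : 0 < d / 2 by rewrite divr_gt0.
have ch : cm h = d / 2 by rewrite cm_real gtr0_norm.
have [|N HN] := fa h _ 1 ltr01; first by rewrite ch; lra.
pose S n := \sum_(0 <= k < n) a k * h ^+ k.
have aS k : cm (a k) * (d / 2) ^+ k = cm (S k.+1 - S k).
  by rewrite /S big_nat_recr//= addrAC subrr add0r cmM cmX ch.
(* The sum absorbs the finitely many terms before [N], the 2 all later ones. *)
exists (2 + \sum_(0 <= k < N) cm (S k.+1 - S k)), (d / 2)^-1; split.
- by rewrite addr_ge0// sumr_ge0// => k _; exact: cm_ge0.
- by rewrite invr_gt0.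
move=> k; rewrite exprVn ler_pdivlMr ?exprn_gt0// aS.
have [kN|Nk] := ltnP k N.
  have := kN; rewrite -[(k < N)%N]/(0 <= k < N)%N -mem_index_iota => kiN.
  rewrite (big_rem k)//= addrCA lerDl addr_ge0// sumr_ge0// => j _.
  exact: cm_ge0.
rewrite (@le_trans _ _ 2)//; last first.
  by rewrite lerDl sumr_ge0// => j _; exact: cm_ge0.
rewrite (le_trans (cm_trans (f (z + h)) _ _))//.
have := HN _ Nk; have := HN _ (leqW Nk); rewrite cmC -/(S _) -/(S _); lra.
Qed.

(** The first nonzero coefficient of positive index gives the leading term; a geometric series
    dominates the rest. If there is none, [f] is constant near [z]. *)
Lemma local_expansion f z a d : 0 < d -> expansion f z a d ->
  (exists2 r : R, 0 < r & forall h, cm h < r -> f (z + h) = f z) \/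
  exists m (b : R[i]) (C r : R), [/\ (0 < m)%N, b != 0, 0 < C, 0 < r &
    forall h, cm h < r -> cm (f (z + h) - f z - b * h ^+ m) <= C * cm h ^+ m.+1].
Proof.
move=> d0 fa; have [M [K [M0 K0 aM]]] := expansion_coef_le d0 fa.
have fz := expansion_coef0 d0 fa.
have [a0|/existsNP[k ak]] := pselect (forall k, a k.+1 = 0).
  left; exists d => // h hd; apply/eqP; rewrite -subr_eq0 -cm_eq0.
  rewrite eq_le cm_ge0 andbT; apply: (cm_lim_le (fa h hd)).
  exists 1%N => -[//|n] _; rewrite big_nat_recl// expr0 mulr1 big1 => [|k _].
    by rewrite fz addr0 subrr cm0.
  by rewrite a0 mul0r.
right; have [|m /eqP am mmin] := @ex_minnP (fun k => a k.+1 != 0).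
  by exists k; apply/eqP.
have r0 : 0 < Num.min d (1 / 2 / K) by rewrite lt_min d0 !divr_gt0.
(* The radius [1 / (2 K)] makes the ratio of the geometric majorant at most 1/2; the added 1 keeps
   the constant positive when [M] is zero. *)
exists m.+1, (a m.+1), (2 * M * K ^+ m.+2 + 1), (Num.min d (1 / 2 / K)).
split=> //; first by apply/eqP.
  by rewrite ltr_wpDl// mulr_ge0 ?exprn_ge0// ?mulr_ge0// ltW.
move=> h; rewrite lt_min => /andP[hd hK].
have Kh : K * cm h <= 1 / 2 by rewrite mulrC -ler_pdivlMr// ltW.
apply: (@le_trans _ _ (2 * M * (K * cm h) ^+ m.+2)); last first.
  rewrite exprMn mulrA ler_wpM2r ?exprn_ge0 ?cm_ge0//; lra.
rewrite -addrA -opprD; apply: (cm_lim_le (fa h hd)).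
exists m.+2 => n mn; rewrite (big_cat_nat _ mn)//= big_nat_recr//=.
rewrite big_nat_recl// big_nat big1 => [|j /andP[_ jm]].
  rewrite expr0 mulr1 addr0 -fz addrAC subrr add0r.
  exact: series_tail_le (ltW K0) Kh.
have [->|aj] := eqVneq (a j.+1) 0; first by rewrite mul0r.
by have := mmin _ aj; rewrite leqNgt jm.
Qed.

End LocalExpansion.

(** * Identity theorem and open mapping *)

Section Analytic.
Variable R : realType.
Implicit Types (f : R[i] -> R[i]) (z h w b c u : R[i]) (r d e : R).

Definition const_near f z c : Prop :=
  exists2 r : R, 0 < r & forall h, cm h < r -> f (z + h) = c.

Definition power_near f z : Prop :=
  exists m b (C r : R), [/\ (0 < m)%N, b != 0, 0 < C, 0 < r &
    forall h, cm h < r -> cm (f (z + h) - f z - b * h ^+ m) <= C * cm h ^+ m.+1].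

Lemma analytic_local (Om : set R[i]^o) f z : analytic_on Om f -> Om z ->
  const_near f z (f z) \/ power_near f z.
Proof. by move=> /analytic_onP/[apply]-[a [d [d0 /(local_expansion d0)]]]. Qed.

Lemma analytic_continuous (Om : set R[i]^o) f z e :
  analytic_on Om f -> Om z -> 0 < e ->
  exists2 d : R, 0 < d & forall h, cm h < d -> cm (f (z + h) - f z) < e.
Proof.
move=> /analytic_local/[apply] -[[r r0 H] e0|[m [b [C [r [m0 b0 C0 r0 H]]]]] e0].
  by exists r => // h /H ->; rewrite subrr cm0.
have D0 : 0 < cm b + C by rewrite addr_gt0// cm_gt0.
(* For [|h| < 1], leading term and error together are at most [(|b| + C) |h|]. *)
exists (Num.min r (Num.min 1 (e / (cm b + C)))).
  by rewrite !lt_min r0 ltr01 divr_gt0.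
move=> h; rewrite !lt_min ltr_pdivlMr// => /and3P[/H {}H h1 he].
rewrite -[_ - _](subrK (b * h ^+ m)) (le_lt_trans (cmD _ _))//.
rewrite cmM cmX; have x0 := cm_ge0 h.
have xm : cm h ^+ m <= cm h.
  case: m m0 {H} => // m _.
  by rewrite exprS ler_piMr// exprn_ile1// ltW.
have b1 : cm b * cm h ^+ m <= cm b * cm h by rewrite ler_wpM2l// cm_ge0.
have c1 : C * cm h ^+ m.+1 <= C * cm h.
  by rewrite ler_wpM2l// ?(ltW C0)// exprS ler_piMr// exprn_ile1// ltW.
nra.
Qed.

(** For [|h| < |b| / (2 C)] the error is at most half of the leading term. *)
Lemma power_near_ge f z : power_near f z -> exists m (B r : R), [/\ 0 < B, 0 < r &
  forall h, cm h < r -> B * cm h ^+ m <= cm (f (z + h) - f z)].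
Proof.
move=> [m [b [C [r [m0 b0 C0 r0 H]]]]].
have cb : 0 < cm b by rewrite cm_gt0.
exists m, (cm b / 2), (Num.min r (cm b / 2 / C)); split.
- by rewrite divr_gt0.
- by rewrite lt_min r0 !divr_gt0.
move=> h; rewrite lt_min ltr_pdivlMr// => /andP[/H {}H hb].
have x0 : 0 <= cm h ^+ m by rewrite exprn_ge0 ?cm_ge0.
have : cm (b * h ^+ m) <= cm (f (z + h) - f z) + cm (f (z + h) - f z - b * h ^+ m).
  rewrite -[cm (_ - _ - _)]cmN opprB addrC.
  by rewrite (le_trans _ (cmD _ _))// subrK.
rewrite cmM cmX; have := H; rewrite exprS; nra.
Qed.

Lemma power_near_isolated f z : power_near f z ->
  exists2 r : R, 0 < r & forall h, h != 0 -> cm h < r -> f (z + h) != f z.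
Proof.
move=> /power_near_ge[m [B [r [B0 r0 H]]]]; exists r => // h h0 /H.
apply: contraTneq => ->; rewrite subrr cm0 -ltNge mulr_gt0//.
by rewrite exprn_gt0// cm_gt0.
Qed.

(** The set [B] of points near which [f] equals [c] is open. It is closed in [Om]: at a limit point
    [f] takes the value [c] by continuity, and points of [B] nearby contradict isolation unless [f]
    is locally constant there. *)
Lemma identity_theorem (Om : set R[i]^o) f z c :
  open Om -> connected Om -> analytic_on Om f -> Om z -> const_near f z c ->
  forall w, Om w -> f w = c.
Proof.
move=> oO cO fO Oz fc.
pose B := Om `&` [set w | const_near f w c].
suff BO : B = Om.
  by move=> w; rewrite -BO => -[_ [r r0 /(_ 0)]]; rewrite cm0 addr0; apply.
have oB : open B.
  apply: nm_open => w [Ow [r r0 H]].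
  have [d d0 dO] := open_nmP oO Ow.
  exists (Num.min d r); first by rewrite lt_min d0.
  move=> y; rewrite lt_min => /andP[yd yr]; split; first exact: dO.
  exists (r - nm (y - w)) => [|h hr]; first by rewrite subr_gt0.
  have -> : y + h = w + ((y - w) + h) :> R[i] by rewrite addrA addrCA subrr addr0.
  by rewrite H// (le_lt_trans (cmD _ _))// addrC -ltrBrDr.
apply: cO.
- by exists z; split.
- exists B => //; apply/seteqP; split=> [w [Ow ?]|w []//].
  by split.
exists (closure B); first exact: closed_closure.
apply/seteqP; split=> [w Bw|w [Ow clw]].
  by split; [case: Bw|exact: subset_closure].
split=> //=.
have nearB d : 0 < d -> exists2 y, B y & cm (y - w) < d.
  move=> d0; have [|y [By yd]] := clw [set y | nm (y - w) < d].
    by apply/(@near_nmP R R[i]^o w); exists d.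
  by exists y.
have fBc y : B y -> f y = c.
  by case=> _ [r r0 /(_ 0)]; rewrite cm0 addr0; apply.
have fwc : f w = c.
  apply/eqP; rewrite -subr_eq0 -cm_eq0 eq_le cm_ge0 andbT.
  apply/ler_addgt0Pr => e e0; rewrite add0r.
  have [d d0 Hd] := analytic_continuous fO Ow e0.
  have [y By /Hd] := nearB d d0.
  by rewrite subrKC fBc// cmC => /ltW.
case: (analytic_local fO Ow) => [|/power_near_isolated[r r0 H]].
  by rewrite fwc.
have [y By yr] := nearB r r0.
have [yw|yw] := eqVneq y w; first by move: By; rewrite yw => -[].
have := H (y - w); rewrite subr_eq0 => /(_ yw yr).
by rewrite subrKC fBc// fwc eqxx.
Qed.

Lemma nonconstant_power_near (Om : set R[i]^o) f z :
  open Om -> connected Om -> analytic_on Om f ->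
  ~ (exists c, forall w, Om w -> f w = c) -> Om z -> power_near f z.
Proof.
move=> oO cO fO ncf Oz; have [fz|//] := analytic_local fO Oz.
by case: ncf; exists (f z); exact: identity_theorem fz.
Qed.

(* The error is at most half of the increment [t c], which moves [f z] in the
   direction [c]. *)
Lemma power_near_direction f z c e : power_near f z -> c != 0 -> 0 < e ->
  exists h (t : R), [/\ cm h < e, 0 < t, t < 1 &
    cm (f (z + h) - f z - t%:C * c) <= t / 2 * cm c].
Proof.
move=> [m [b [C [r [m0 b0 C0 r0 H]]]]] c0 e0.
(* With [b u^m = c], the displacement [h = s u] has leading term [s^m c], so [t = s^m]. *)
pose u := m.-root (c / b).
have um : u ^+ m = c / b by rewrite rootCK.
have u0 : 0 < cm u.
  rewrite cm_gt0; apply: contra_neq c0 => u0; move: um; rewrite u0 expr0n.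
  rewrite eqn0Ngt m0/= => /esym/eqP; rewrite mulf_eq0 invr_eq0 (negbTE b0) orbF.
  by move/eqP.
have D0 : 0 < C * cm u ^+ m.+1 by rewrite mulr_gt0 ?exprn_gt0.
(* The last bound on [s] brings the error [C |s u|^(m+1)] below [s^m |c| / 2]. *)
pose s := Num.min (1 / 2)
  (Num.min (Num.min r e / 2 / cm u) (cm c / 2 / (C * cm u ^+ m.+1))).
have re0 : 0 < Num.min r e by rewrite lt_min r0.
have s0 : 0 < s by rewrite !lt_min !divr_gt0// cm_gt0.
have : s <= s by []; rewrite {2}/s !le_min => /and3P[s1 sr sC].
have hs : cm (s%:C * u) = s * cm u by rewrite cmM cm_real gtr0_norm.
have : cm (s%:C * u) < Num.min r e.
  by move: sr; rewrite ler_pdivlMr// hs => /le_lt_trans; apply; lra.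
rewrite lt_min => /andP[hr he].
exists (s%:C * u), (s ^+ m); split=> //.
- by rewrite exprn_gt0.
- by rewrite exprn_ilt1 -?lt0n ?ltW//; lra.
have -> : (s ^+ m)%:C * c = b * (s%:C * u) ^+ m.
  by rewrite exprMn um rmorphXn mulrCA mulrA (mulrC c) -!mulrA mulVKf.
rewrite (le_trans (H _ hr))// hs exprMn exprS.
move: sC; rewrite ler_pdivlMr//; have := exprn_gt0 m s0; nra.
Qed.

(** The disc is carried to [R * R], where it is a closed part of a compact square. *)
Lemma compact_disc_min (F : R[i] -> R) r : 0 <= r ->
  (forall h, cm h <= r -> forall e, 0 < e -> exists2 d : R, 0 < d &
    forall h', cm h' <= r -> cm (h' - h) < d -> `|F h' - F h| < e) ->
  exists2 h, cm h <= r & forall h', cm h' <= r -> F h <= F h'.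
Proof.
move=> r0 Fc.
pose q (p : R * R) := p.1 ^+ 2 + p.2 ^+ 2.
have cmq (p : R * R) : (cm (p.1 +i* p.2) <= r) = (q p <= r ^+ 2).
  by rewrite -(ler_pXn2r (isT : 0 < 2)%N) ?nnegrE ?cm_ge0// cm_sqr.
pose A := (`[- r, r] `*` `[- r, r]) `&` (q @^-1` [set x | x <= r ^+ 2]).
have cA : compact A.
  apply: compact_closedI; first by apply: compact_setX; exact: segment_compact.
  apply: closed_comp; last exact: closed_le.
  move=> p _; rewrite /q.
  apply: (@continuousD _ _ _ (fun p : R * R => p.1 ^+ 2) (fun p => p.2 ^+ 2)).
    apply: (@continuous_comp _ _ _ fst (fun x : R => x ^+ 2)).
      exact: cvg_fst.
    exact: exprn_continuous.
  apply: (@continuous_comp _ _ _ snd (fun x : R => x ^+ 2)).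
    exact: cvg_snd.
  exact: exprn_continuous.
have AP (p : R * R) : A p <-> cm (p.1 +i* p.2) <= r.
  rewrite /A/= cmq; split=> [[]//|pr]; split=> //.
  rewrite -cmq in pr; have := cm_Re (p.1 +i* p.2); have := cm_Im (p.1 +i* p.2).
  by rewrite /= !in_itv/= => i1 r1; rewrite -!ler_norml; split; exact: le_trans pr.
have [||[x y] /set_mem/AP xyr Hmin] :=
    @compact_EVT_min _ _ (fun p : R * R => F (p.1 +i* p.2)) A _ cA.
- by exists (0, 0); apply/AP; rewrite -[_ +i* _]/(0 : R[i]) cm0.
- apply/subspace_continuousP => -[x y] /AP xyr.
  apply/cvgrPdist_lt => e e0; have [d d0 Hd] := Fc _ xyr e e0.
  have d2 : 0 < d / 2 by rewrite divr_gt0.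
  rewrite near_withinE; exists (ball x (d / 2), ball y (d / 2)).
    by split; apply: nbhsx_ballx.
  move=> [x' y'] [/= xx yy] /AP/= xyr'; rewrite distrC; apply: Hd => //.
  rewrite (le_lt_trans (cm_ReIm _))//=.
  by move: xx yy; rewrite /ball/= distrC => xx; rewrite distrC; lra.
exists (x +i* y) => // -[x' y'] xyr'.
by apply: (Hmin (x', y')); apply/mem_set/AP.
Qed.

(* Near [w] the minimum of [|f - w|] over a closed disc is attained in the
   interior, where [power_near_direction] forces it to be zero. *)
Lemma open_mapping (Om : set R[i]^o) f z e :
  open Om -> connected Om -> analytic_on Om f ->
  ~ (exists c, forall w, Om w -> f w = c) -> Om z -> 0 < e ->
  exists2 d : R, 0 < d & forall w, cm (w - f z) < d ->
    exists h, [/\ cm h < e, Om (z + h) & f (z + h) = w].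
Proof.
move=> oO cO fO ncf Oz e0.
have pw y : Om y -> power_near f y by exact: nonconstant_power_near.
have [d0 d00 HO] := open_nmP oO Oz.
have [m [B [r0 [B0 r00 HB]]]] := power_near_ge (pw z Oz).
pose r := Num.min e (Num.min d0 r0) / 2.
have rr0 : 0 < Num.min e (Num.min d0 r0) by rewrite !lt_min e0 d00.
have r_gt0 : 0 < r by rewrite divr_gt0.
have : r < Num.min e (Num.min d0 r0) by rewrite /r; lra.
rewrite !lt_min => /and3P[re rd rr].
have Oh h : cm h <= r -> Om (z + h).
  by move=> hr; apply: HO; rewrite addrC addKr nm_cm (le_lt_trans hr).
have D0 : 0 < B * r ^+ m by rewrite mulr_gt0// exprn_gt0.
(* On the circle [|h| = r], [f] stays at distance at least [B r^m] from [f z]. If [w] is within half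
   of that, [|f - w|] is smaller at the centre than anywhere on the circle. *)
exists (B * r ^+ m / 2); first by rewrite divr_gt0.
move=> w wz; pose F h := cm (f (z + h) - w).
have [h|h hr Hmin] := @compact_disc_min F r (ltW r_gt0).
  move=> hr ep ep0; have [d d_gt0 Hd] := analytic_continuous fO (Oh h hr) ep0.
  exists d => // h' _ /Hd; rewrite -addrA subrKC => H.
  rewrite ltr_norml /F; have := cm_trans (f (z + h)) (f (z + h')) w.
  have := cm_trans (f (z + h')) (f (z + h)) w; rewrite (cmC (f (z + h)) (f (z + h'))).
  by move: H => *; apply/andP; split; lra.
have F0 : F h < B * r ^+ m / 2.
  rewrite (le_lt_trans (Hmin 0 _)) ?cm0 ?(ltW r_gt0)//.
  by rewrite /F addr0 cmC.
have hr' : cm h < r.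
  rewrite lt_neqAle hr andbT; apply/eqP => hrE.
  have := HB h; rewrite hrE => /(_ rr).
  have := cm_trans w (f (z + h)) (f z); move: F0; rewrite /F; lra.
exists h; split; [exact: lt_trans re|exact: Oh|].
apply/eqP; apply: contraT => fw.
have c0 : w - f (z + h) != 0 by rewrite subr_eq0 eq_sym.
have rh : 0 < r - cm h by rewrite subr_gt0.
have [h' [t [h'r t0 t1 Ht]]] := power_near_direction (pw _ (Oh h hr)) c0 rh.
have hh : cm (h + h') <= r by rewrite (le_trans (cmD _ _))//; lra.
have := Hmin _ hh; rewrite leNgt => /negP; case; rewrite /F.
(* The bracket is at most [t / 2] times [|w - f (z + h)|] and the remainder is [1 - t] times it, so
   the new distance is strictly smaller than the minimum. *)
have -> : f (z + (h + h')) - w =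
   (f (z + h + h') - f (z + h) - t%:C * (w - f (z + h))) -
     (1 - t)%:C * (w - f (z + h)).
  by rewrite addrA rmorphB rmorph1; ring.
rewrite (le_lt_trans (cmB _ _))// cmM cm_real gtr0_norm ?subr_gt0//.
rewrite (cmC (f (z + h)) w).
move: c0; rewrite -cm_gt0; nra.
Qed.

End Analytic.

(** * Reciprocals *)

Section Reciprocal.
Variable R : realType.
Implicit Types (a b : nat -> R[i]) (f : R[i] -> R[i]) (z h : R[i]).

(* The coefficients [b] of the reciprocal series solve
   [\sum_(j <= n) a (n - j) * b j = (n == 0)]. *)
Fixpoint recip_seq a n : seq R[i] :=
  if n is k.+1 then
    let s := recip_seq a k in
    rcons s ((a 0%N)^-1 * ((k == 0)%:R - \sum_(0 <= j < k) a (k - j)%N * s`_j))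
  else [::].

Lemma size_recip_seq a n : size (recip_seq a n) = n.
Proof. by elim: n => //= n IH; rewrite size_rcons IH. Qed.

Definition recip_coef a n : R[i] := (recip_seq a n.+1)`_n.

Lemma nth_recip_seq a n j : (j < n)%N -> (recip_seq a n)`_j = recip_coef a j.
Proof.
elim: n => // n IH; rewrite ltnS leq_eqVlt => /predU1P[-> //|jn].
by rewrite /= nth_rcons size_recip_seq jn IH.
Qed.

Lemma recip_coefE a n : recip_coef a n =
  (a 0%N)^-1 * ((n == 0)%:R - \sum_(0 <= j < n) a (n - j)%N * recip_coef a j).
Proof.
rewrite /recip_coef /= nth_rcons size_recip_seq ltnn eqxx.
congr (_ * (_ - _)); apply: eq_big_nat => j /andP[_ jn].
by rewrite nth_recip_seq.
Qed.

Lemma recip_coef_convol a n : a 0%N != 0 ->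
  \sum_(0 <= j < n.+1) a (n - j)%N * recip_coef a j = (n == 0)%:R.
Proof.
move=> a0; rewrite big_nat_recr//= subnn [in X in _ + X]recip_coefE.
by rewrite mulVKf// addrC subrK.
Qed.

(** Strong induction on the recurrence, with [B] the modulus of [1 / a 0]. The rate
    [L = K (1 + M B)] is chosen so that the majorised convolution telescopes to [L^k - K^k]. *)
Lemma recip_coef_le a (M K : R) n : (forall k, cm (a k) <= M * K ^+ k) ->
  0 <= M -> 0 <= K ->
  cm (recip_coef a n) <=
    cm (a 0%N)^-1 * (K * (1 + M * cm (a 0%N)^-1)) ^+ n.
Proof.
move=> aM M0 K0; set B := cm (a 0%N)^-1; set L := K * _.
have B0 : 0 <= B by exact: cm_ge0.
have L0 : 0 <= L by rewrite mulr_ge0// addr_ge0// mulr_ge0.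
have T k : M * B * \sum_(0 <= j < k) K ^+ (k - j) * L ^+ j <= L ^+ k - K ^+ k.
  elim: k => [|k IH]; first by rewrite big_nil mulr0 subrr.
  rewrite big_nat_recr//= subSnn expr1.
  have -> : \sum_(0 <= j < k) K ^+ (k.+1 - j) * L ^+ j =
            K * \sum_(0 <= j < k) K ^+ (k - j) * L ^+ j.
    rewrite mulr_sumr; apply: eq_big_nat => j /andP[_ jk].
    by rewrite subSn 1?ltnW// exprS mulrA.
  have LE : L ^+ k.+1 = K * L ^+ k + K * (M * B * L ^+ k).
    by rewrite exprS {1}/L; ring.
  rewrite LE exprS; move: IH; set S := \sum_(_ <= _ < _) _ => IH.
  have : K * (M * B * S) <= K * (L ^+ k - K ^+ k) by rewrite ler_wpM2l.
  lra.
elim/ltn_ind: n => n IH; rewrite recip_coefE.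
case: n IH => [|n] IH; first by rewrite big_nil subr0 mulr1 mulr1.
rewrite sub0r cmM cmN -/B ler_wpM2l//.
rewrite (le_trans (cm_sum _ _ _))//.
apply: (@le_trans _ _ (\sum_(0 <= j < n.+1) M * B * (K ^+ (n.+1 - j) * L ^+ j))).
  rewrite big_nat [leRHS]big_nat; apply: ler_sum => j /andP[_ jn].
  rewrite cmM mulrACA ler_pM ?cm_ge0//; exact: IH.
rewrite -mulr_sumr (le_trans (T _))// gerBl exprn_ge0//.
Qed.

(** The partial sums of the reciprocal series, multiplied by [F = f (z + h)], differ from 1 by
    [O(2^-n)]; dividing by [F] gives convergence. *)
Lemma expansion_inv f z a (d : R) : 0 < d -> expansion f z a d ->
  (forall h, cm h < d -> f (z + h) != 0) ->
  exists2 d' : R, 0 < d' & expansion (fun w => (f w)^-1) z (recip_coef a) d'.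
Proof.
move=> d0 fa fn0; have [M [K [M0 K0 aM]]] := expansion_coef_le d0 fa.
have a0 : a 0%N != 0.
  by rewrite -(expansion_coef0 d0 fa) -[z]addr0 fn0// cm0.
pose b := recip_coef a; set B := cm (a 0%N)^-1.
pose L := K * (1 + M * B).
have B0 : 0 <= B by exact: cm_ge0.
have KL : K <= L by rewrite ler_peMr ?(ltW K0)// lerDl mulr_ge0.
have L0 : 0 < L by exact: lt_le_trans KL.
(* Of the factor [4^-n] gained here, one [2^-n] pays for the number of terms and the other remains
   as the rate of convergence. *)
exists (Num.min d (1 / 4 / L)); first by rewrite lt_min d0 !divr_gt0.
move=> h; rewrite lt_min ltr_pdivlMr// => /andP[hd hL] e e0.
have h0 := cm_ge0 h.
have Kh : K * cm h <= 1 / 2 by nra.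
have F0 := fn0 h hd; set F := f (z + h) in F0 *.
pose P n := \sum_(0 <= k < n) a k * h ^+ k.
have PF n : cm (F - P n) <= 2 * M * (K * cm h) ^+ n.
  apply: (cm_lim_le (fa h hd)); exists n => m nm_.
  rewrite (big_cat_nat _ nm_)//= addrAC subrr add0r.
  exact: series_tail_le (ltW K0) Kh.
(* The Cauchy product summed over the triangle of total degree at most [n]; every positive degree
   contributes zero. *)
have D n : \sum_(0 <= j < n.+1) b j * h ^+ j * P (n.+1 - j)%N = 1.
  elim: n => [|n IH].
    have := recip_coef_convol 0 a0.
    by rewrite !big_nat1 /P big_nat1 !expr0 !mulr1 mulrC.
  rewrite big_nat_recr//= subSnn {2}/P big_nat1 expr0 mulr1.
  rewrite -{}[RHS]IH.
  transitivity (\sum_(0 <= j < n.+1) b j * h ^+ j * P (n.+1 - j)%N +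
     h ^+ n.+1 * \sum_(0 <= j < n.+2) a (n.+1 - j)%N * b j).
    rewrite [X in _ = _ + _ * X]big_nat_recr//= subnn mulrDr addrA.
    congr (_ + _); last by ring.
    rewrite mulr_sumr -big_split/=; apply: eq_big_nat => j /andP[_ jn].
    rewrite (subSn (ltnW jn)) {1}/P big_nat_recr//= mulrDr; congr (_ + _).
    have -> : h ^+ n.+1 = h ^+ j * h ^+ (n.+1 - j) by rewrite -exprD subnKC// ltnW.
    by ring.
  by rewrite recip_coef_convol// mulr0 addr0.
(* Replacing 1 by [D] turns the difference into a sum of [b j * h ^+ j] times the tail of [f] from
   degree [n - j] on, and all summands share one bound. *)
have Q n : cm (1 - F * \sum_(0 <= j < n) b j * h ^+ j) * 2 ^+ n <= 2 * M * B + 1.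
  case: n => [|n].
    rewrite big_nil mulr0 subr0 cm1 mulr1.
    by rewrite lerDr !mulr_ge0.
  rewrite -(D n) mulr_sumr -sumrB.
  have x0 : 0 <= L * cm h by rewrite mulr_ge0// ltW.
  have [n1 n2] : n.+1%:R <= 2 ^+ n.+1 :> R /\ (L * cm h * 4) ^+ n.+1 <= 1.
    split; last by rewrite exprn_ile1//; lra.
    by rewrite -natrX ler_nat ltnW// ltn_expl.
  have : cm (\sum_(0 <= j < n.+1)
     (b j * h ^+ j * P (n.+1 - j)%N - F * (b j * h ^+ j))) <=
     n.+1%:R * (2 * M * B * (L * cm h) ^+ n.+1).
    rewrite (le_trans (cm_sum _ _ _))//.
    rewrite -[in leRHS](subn0 n.+1) mulr_natl -sumr_const_nat.
    rewrite big_nat [leRHS]big_nat; apply: ler_sum => j /andP[_ jn].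
    rewrite (mulrC F) -mulrBr cmM cmM cmX cmC.
    have -> : 2 * M * B * (L * cm h) ^+ n.+1 =
      B * (L * cm h) ^+ j * (2 * M * (L * cm h) ^+ (n.+1 - j)).
      by rewrite -[in LHS](subnKC (ltnW jn)) exprD; ring.
    apply: ler_pM; rewrite ?mulr_ge0 ?cm_ge0 ?exprn_ge0//.
      rewrite exprMn mulrA; apply: ler_wpM2r; first exact: exprn_ge0.
      exact: recip_coef_le (ltW K0).
    rewrite (le_trans (PF _))// ler_wpM2l ?mulr_ge0//.
    by apply: lerXn2r; [exact: (mulr_ge0 (ltW K0) h0)|exact: x0|exact: ler_wpM2r].
  move=> H.
  apply: (@le_trans _ _
    (2 ^+ n.+1 * (2 * M * B * (L * cm h) ^+ n.+1) * 2 ^+ n.+1)).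
    rewrite ler_wpM2r ?exprn_ge0// (le_trans H)// ler_wpM2r// !mulr_ge0// exprn_ge0//.
  have -> : 2 ^+ n.+1 * (2 * M * B * (L * cm h) ^+ n.+1) * 2 ^+ n.+1 =
            2 * M * B * (L * cm h * 4) ^+ n.+1.
    have -> : 4 = 2 * 2 :> R by rewrite -natrM.
    by rewrite !exprMn; ring.
  have : 0 <= 2 * M * B by rewrite !mulr_ge0.
  nra.
have cF : 0 < cm F by rewrite cm_gt0.
pose c := (2 * M * B + 1) / (cm F * e).
exists (Num.bound c) => n Nn.
have -> : F^-1 - \sum_(0 <= k < n) b k * h ^+ k =
          F^-1 * (1 - F * \sum_(0 <= k < n) b k * h ^+ k).
  by rewrite mulrBr mulr1 mulKf.
rewrite cmM cmV mulrC ltr_pdivrMr// -(ltr_pM2r (exprn_gt0 n (ltr0n R 2))).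
rewrite (le_lt_trans (Q n))//.
have c0 : 0 <= c by rewrite divr_ge0 ?addr_ge0 ?mulr_ge0// ?(ltW e0) ?(ltW cF).
have : c < 2 ^+ n.
  rewrite (lt_le_trans (archi_boundP c0))// (@le_trans _ _ n%:R) ?ler_nat//.
  by rewrite -natrX ler_nat ltnW// ltn_expl.
rewrite /c ltr_pdivrMr ?mulr_gt0// => /lt_le_trans; apply.
by rewrite mulrC (mulrC (cm F)).
Qed.

Lemma analytic_on_inv (Om : set R[i]^o) f : open Om -> analytic_on Om f ->
  (forall w, Om w -> f w != 0) -> analytic_on Om (fun w => (f w)^-1).
Proof.
move=> oO /analytic_onP fO fn0; apply/analytic_onP => z Oz.
have [a [d [d0 H]]] := fO z Oz; have [d1 d10 HO] := open_nmP oO Oz.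
have [|h|h|d' d'0 H'] := @expansion_inv f z a (Num.min d d1).
- by rewrite lt_min d0.
- by rewrite lt_min => /andP[hd _]; exact: H.
- by rewrite lt_min => /andP[_ hd]; apply/fn0/HO; rewrite addrC addKr nm_cm.
by exists (recip_coef a), d'.
Qed.

End Reciprocal.

(** * Density of the roots of unity *)

Section RootsOfUnity.
Variable R : realType.

Definition cis (t : R) : R[i] := cos t +i* sin t.

Lemma cisD s t : cis (s + t) = cis s * cis t.
Proof.
rewrite /cis cosD sinD; apply/eqP; rewrite eq_complex/=.
by rewrite eqxx/= addrC.
Qed.

Lemma cis0 : cis 0 = 1. Proof. by rewrite /cis cos0 sin0. Qed.

Lemma cisX t n : cis t ^+ n = cis (t *+ n).
Proof. by elim: n => [|n IH]; rewrite ?cis0// exprS IH mulrS cisD. Qed.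

Lemma cis2pi : cis (pi *+ 2) = 1.
Proof. by rewrite /cis cos2pi sin2pi. Qed.

Lemma cm_cis t : cm (cis t) = 1.
Proof.
apply/eqP; rewrite -(@pexpr_eq1 _ _ 2) ?cm_ge0// cm_sqr/=.
by rewrite cos2Dsin2.
Qed.

(** A nonnegative angle is chosen so that rational multiples of [2 pi] just above it are
    positive. *)
Lemma cis_surj (z : R[i]) : cm z = 1 -> exists2 t, 0 <= t & cis t = z.
Proof.
case: z => x y z1; have := cm_sqr (x +i* y); rewrite z1 expr1n /= => xy.
have x1 : -1 <= x <= 1 by have := cm_Re (x +i* y); rewrite z1 ler_norml.
have [/andP[a0 a1] ac] := acos_def x1.
have sa : sin (acos x) = `|y|.
  by rewrite sin_acos// xy addrC addKr sqrtr_sqr.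
have [y0|y0] := leP 0 y.
  by exists (acos x) => //; rewrite /cis ac sa ger0_norm.
exists (pi *+ 2 - acos x).
  by rewrite subr_ge0 (le_trans a1)// mulr2n lerDl pi_ge0.
rewrite /cis addrC cosD2pi sinD2pi cosN sinN ac sa ltr0_norm// opprK //.
Qed.

(** Take a rational multiple [s] of [2 pi] slightly above the angle [t] of [z]; its denominator
    serves as [n]. Since [0 < s - t < pi], the sine of [s - t] is positive and the two points
    differ. *)
Lemma roots_of_unity_near (z : R[i]) (e : R) : cm z = 1 -> 0 < e ->
  exists (w : R[i]) n, [/\ (0 < n)%N, w ^+ n = 1, w != z & cm (w - z) < e].
Proof.
move=> /cis_surj[t t0 <-] e0; have e20 : 0 < e / 2 by rewrite divr_gt0.
have [d d0 Hd] : exists2 d : R, 0 < d & forall s, `|t - s| < d ->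
    `|cos t - cos s| < e / 2 /\ `|sin t - sin s| < e / 2.
  have /cvgrPdist_lt/(_ _ e20)/nbhs_ballP[d1 /= d10 H1] := @continuous_cos R t.
  have /cvgrPdist_lt/(_ _ e20)/nbhs_ballP[d2 /= d20 H2] := @continuous_sin R t.
  exists (Num.min d1 d2) => [|s]; first by rewrite lt_min d10.
  by rewrite lt_min => /andP[s1 s2]; split; [exact: H1|exact: H2].
have pi2 : 0 < pi *+ 2 :> R by rewrite mulrn_wgt0// pi_gt0.
have [|q] := @rat_in_itvoo R (t / (pi *+ 2)) ((t + Num.min d pi) / (pi *+ 2)).
  by rewrite ltr_pM2r ?invr_gt0// ltrDl lt_min d0 pi_gt0.
rewrite in_itv/= ltr_pdivrMr// ltr_pdivlMr// -ltrBlDl lt_min.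
set s := _ * _ => /and3P[ts sd sp].
have q0 : 0 < q.
  by rewrite -(ltr0q R) -(pmulr_lgt0 _ pi2) (le_lt_trans t0).
exists (cis s), `|denq q|%N; split.
- by rewrite absz_gt0 denq_neq0.
- rewrite cisX -[RHS](expr1n _ `|numq q|%N) -[in RHS]cis2pi cisX; congr cis.
  rewrite /s -mulr_natl mulrA -[RHS]mulr_natl; congr (_ * _).
  have nE : numq q = `|numq q|%N by rewrite gez0_abs// ltW// numq_gt0.
  have dE : denq q = `|denq q|%N by rewrite gez0_abs// ltW// denq_gt0.
  rewrite /ratr nE dE !absz_nat -!pmulrn mulrC divfK//.
  by rewrite pnatr_eq0 absz_eq0 denq_neq0.
- apply/eqP => st; have := cisD (s - t) t; rewrite subrK st => /esym/eqP.
  rewrite -subr_eq0 -{2}[cis t]mul1r -mulrBl mulf_eq0.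
  rewrite -[cis t == 0]cm_eq0 cm_cis oner_eq0 orbF.
  rewrite subr_eq0 eq_complex/= => /andP[_ /eqP sst].
  have := @sin_gt0_pi R (s - t); rewrite sst ltxx subr_gt0 ts sp => /(_ isT).
  by [].
have [|c1 s1] := Hd s; first by rewrite distrC gtr0_norm ?subr_gt0.
rewrite cmC (le_lt_trans (cm_ReIm _))//=; lra.
Qed.

End RootsOfUnity.

(** * Hahn-Banach separation *)

Section HahnBanach.
Variables (R : realType) (V : normedModType R[i]).
Implicit Types (G : set (V * R)) (x y v : V) (s t a : R).

(* Partial real-linear functionals dominated by the norm are handled as graphs
   in [V * R]; domination makes such a graph single-valued. *)
Definition rlin_graph G : Prop := forall a x s y t,
  G (x, s) -> G (y, t) -> G (a%:C *: x + y, a * s + t).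

Definition norm_dominated G : Prop := forall x s, G (x, s) -> s <= nm x.

(** The value [c] at [v] has to lie between [s - |x - v|] and [|y + v| - t] for all graph points
    [(x, s)] and [(y, t)]. Since [s + t <= |x + y|], the triangle inequality orders these bounds,
    and the supremum of the lower ones serves. *)
Lemma graph_extend G v : rlin_graph G -> norm_dominated G -> G (0, 0) ->
  exists G', [/\ G `<=` G', rlin_graph G', norm_dominated G' & exists s, G' (v, s)].
Proof.
move=> lG dG G0.
pose A := [set t | exists x s, G (x, s) /\ t = s - nm (x - v)].
have A0 : A !=set0 by exists (0 - nm (0 - v)), 0, 0.
have Aub y s : G (y, s) -> ubound A (nm (y + v) - s).
  move=> Gy _ [x [t [Gx ->]]].
  have /dG := lG 1 x t y s Gx Gy; rewrite scale1r mul1r => H.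
  have : nm (x + y) <= nm (x - v) + nm (y + v).
    have -> : x + y = (x - v) + (y + v) by rewrite addrACA addNr addr0.
    exact: nmD.
  lra.
pose c := sup A.
have c_le y s : G (y, s) -> c <= nm (y + v) - s.
  by move=> Gy; apply: ge_sup => //; exact: Aub.
have c_ge x s : G (x, s) -> s - nm (x - v) <= c.
  move=> Gx; apply: ub_le_sup; last by exists x, s.
  by exists (nm (0 + v) - 0); exact: Aub.
pose G' := [set p | exists x s a, G (x, s) /\ p = (x + a%:C *: v, s + a * c)].
have GZ a x s : G (x, s) -> G (a%:C *: x, a * s).
  by move=> Gx; have := lG a x s 0 0 Gx G0; rewrite !addr0.
exists G'; split.
- by move=> [x s] Gx; exists x, s, 0; rewrite rmorph0 scale0r mul0r !addr0.
- move=> a _ _ _ _ [x [s [b [Gx [-> ->]]]]] [y [t [b' [Gy [-> ->]]]]].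
  exists (a%:C *: x + y), (a * s + t), (a * b + b'); split; first exact: lG.
  congr pair; last by ring.
  by rewrite rmorphD rmorphM/= scalerDl scalerDr scalerA addrACA.
- move=> _ _ [x [s [a [Gx [-> ->]]]]].
  (* After division by [|a|], the sign of [a] decides which bound on [c] applies. *)
  have [a0|a0|->] := ltgtP a 0; last first.
  + by rewrite rmorph0 scale0r mul0r !addr0 dG.
  + have := c_le _ _ (GZ a^-1 _ _ Gx); rewrite -(ler_pM2l a0) mulrBr mulVKf ?gt_eqF//.
    have -> : x + a%:C *: v = a%:C *: ((a^-1)%:C *: x + v).
      by rewrite scalerDr scalerA -rmorphM/= mulfV ?gt_eqF// rmorph1 scale1r.
    by rewrite nmZ cm_real gtr0_norm//; lra.
  + have na0 : 0 < - a by rewrite oppr_gt0.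
    have := c_ge _ _ (GZ (- a)^-1 _ _ Gx); rewrite -(ler_pM2l na0) mulrBr mulVKf ?gt_eqF//.
    have -> : x + a%:C *: v = (- a)%:C *: (((- a)^-1)%:C *: x - v).
      rewrite scalerBr scalerA -rmorphM/= mulfV ?gt_eqF// rmorph1 scale1r.
      by rewrite rmorphN scaleNr opprK.
    by rewrite nmZ cm_real gtr0_norm//; lra.
by exists c, 0, 0, 1; rewrite rmorph1 scale1r mul1r !add0r.
Qed.

Lemma norm_dominated_extension G0 : rlin_graph G0 -> norm_dominated G0 ->
  G0 (0, 0) ->
  exists u : V -> R, [/\ forall a x y, u (a%:C *: x + y) = a * u x + u y,
    forall x, u x <= nm x & forall x s, G0 (x, s) -> u x = s].
Proof.
move=> l0 d0 G00.
(* Adding [G0] inside [P] makes the empty set, the union of the empty chain, admissible for Zorn's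
   lemma. *)
pose P := [set G | rlin_graph (G `|` G0) /\ norm_dominated (G `|` G0)].
have [F FP Ftot|A [[lA dA] Amax]] := @Zorn_bigcup _ P.
  split=> [a x s y t|x s [[G FG Gx]|]]; last exact: d0.
  - move=> [[G FG Gx]|Gx] [[H FH Hy]|Hy].
    + case: (Ftot _ _ FG FH) => sub.
        have [lH _] := FP _ FH.
        have [?|?] := lH a x s y t (or_introl (sub _ Gx)) (or_introl Hy).
          by left; exists H.
        by right.
      have [lH _] := FP _ FG.
      have [?|?] := lH a x s y t (or_introl Gx) (or_introl (sub _ Hy)).
        by left; exists G.
      by right.
    + have [lH _] := FP _ FG.
      have [?|?] := lH a x s y t (or_introl Gx) (or_intror Hy).
        by left; exists G.
      by right.
    + have [lH _] := FP _ FH.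
      have [?|?] := lH a x s y t (or_intror Gx) (or_introl Hy).
        by left; exists H.
      by right.
    + by right; exact: l0.
  - by have [_ dG] := FP _ FG; apply: dG; left.
pose G := A `|` G0.
have G_0 : G (0, 0) by right.
have tot v : exists s, G (v, s).
  (* At a vector without a value, [graph_extend] would give a strictly larger element of [P]. *)
  apply: contrapT => nv.
  have [G' [GG' lG' dG' [s G's]]] := graph_extend v lA dA G_0.
  have G'E : G' `|` G0 = G'.
    by apply/seteqP; split=> [p []// G0p|p]; [apply: GG'; right|left].
  apply: (Amax G'); last by split; rewrite G'E.
  split=> [p Ap|G'A]; first by apply: GG'; left.
  by apply: nv; exists s; left; exact: G'A.
have GN x s : G (x, s) -> G (- x, - s).
  move=> Gx; have := lA (-1) x s 0 0 Gx G_0.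
  by rewrite !addr0 mulN1r rmorphN rmorph1 scaleN1r.
have uniqG x s t : G (x, s) -> G (x, t) -> s = t.
  move=> Gs Gt; apply/le_anti/andP; split.
    have /dA := lA 1 _ _ _ _ Gs (GN _ _ Gt).
    by rewrite rmorph1 scale1r subrr nm0 mul1r subr_le0.
  have /dA := lA 1 _ _ _ _ Gt (GN _ _ Gs).
  by rewrite rmorph1 scale1r subrr nm0 mul1r subr_le0.
have [u uG] := choice tot.
exists u; split=> [a x y|x|x s G0x].
- exact: uniqG (uG _) (lA _ _ _ _ _ (uG x) (uG y)).
- exact: dA (uG x).
- by apply: (uniqG _ _ _ (uG x)); right.
Qed.

End HahnBanach.

(** * Operator norms and bounded linear maps in real terms *)

Section BoundedOperators.
Variables (R : realType) (V W : normedModType R[i]).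

Lemma clin_nm (T : clin V W) x : nm (T x) <= nm T * nm x.
Proof. by have := opnormP T x; rewrite -[opnorm T]/`|T| !nmE -rmorphM lecR. Qed.

Lemma nm_clin_le (T : clin V W) (c : R) : 0 <= c ->
  (forall x, nm (T x) <= c * nm x) -> nm T <= c.
Proof.
move=> c0 H; rewrite -nm_le; apply: opnorm_le; first by rewrite lecR.
by move=> x; rewrite !nmE -rmorphM lecR.
Qed.

Lemma clin_of_bounded (f : V -> W) (c : R) : linear f ->
  (forall x, nm (f x) <= c * nm x) -> exists T : clin V W, forall x, T x = f x.
Proof.
move=> lf fc; suff H : f \in @clin_pred R V W by exists (Clin H).
apply/asboolP; split=> //.
pose A : {linear V -> W} := HB.pack f (GRing.isLinear.Build _ _ _ _ f lf).
apply: (@bounded_linear_continuous _ _ _ A); apply/linear_boundedP.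
exists c%:C; split; first by rewrite complex_real.
move=> r cr x; rewrite (@le_trans _ _ (c%:C * `|x|))//.
  by rewrite !nmE -rmorphM lecR.
by rewrite ler_wpM2r// ltW.
Qed.

End BoundedOperators.

(** * Separating a point from a complex subspace *)

Section Separation.
Variables (R : realType) (V : normedModType R[i]).

Definition subspace_set (D : set V) : Prop :=
  D 0 /\ forall (a : R[i]) x y, D x -> D y -> D (a *: x + y).

(** The real functional [y + t v |-> t d] on [D + R v] is dominated by the norm, because
    [|y + t v| = t |-y/t - v| >= t d] for [t > 0]. It is extended to all of [V] and then made
    complex-linear. *)
Lemma hahn_banach_separation (D : set V) (v : V) (d : R) : subspace_set D ->
  0 < d -> (forall y, D y -> d <= nm (y - v)) ->
  exists F : dual V, (forall y, D y -> F y = 0) /\ F v != 0.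
Proof.
move=> [D0 lD] d0 Dv.
have DZ (a : R[i]) y : D y -> D (a *: y).
  by move=> Dy; rewrite -[_ *: _]addr0; exact: lD.
pose G0 : set (V * R) := [set p | exists y t, D y /\ p = (y + t%:C *: v, t * d)].
have [||| u [lu nu uG]] := @norm_dominated_extension R V G0.
- move=> a _ _ _ _ [x [s [Dx [-> ->]]]] [y [t [Dy [-> ->]]]].
  exists (a%:C *: x + y), (a * s + t); split; first exact: lD.
  congr pair; last by ring.
  by rewrite rmorphD rmorphM/= scalerDl scalerDr scalerA addrACA.
- move=> _ _ [y [t [Dy [-> ->]]]].
  have [t0|t0] := leP t 0.
    by rewrite (le_trans _ (nm_ge0 _))// mulr_le0_ge0// ltW.
  have -> : y + t%:C *: v = (- t)%:C *: ((- t^-1)%:C *: y - v).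
    rewrite scalerBr scalerA -rmorphM/= mulrNN mulfV ?gt_eqF// rmorph1 scale1r.
    by rewrite rmorphN scaleNr opprK.
  rewrite nmZ cm_real normrN gtr0_norm// ler_wpM2l ?(ltW t0)// Dv//.
  exact: DZ.
- by exists 0, 0; rewrite rmorph0 scale0r addr0 mul0r.
have u0 : u 0 = 0.
  have := lu (-1) 0 0; rewrite scaler0 addr0 => H.
  by move: H; lra.
have uD x y : u (x + y) = u x + u y by have := lu 1 x y; rewrite rmorph1 scale1r mul1r.
have uZ a x : u (a%:C *: x) = a * u x by have := lu a x 0; rewrite !addr0 u0 addr0.
have uN x : u (- x) = - u x by rewrite -scaleN1r -(rmorphN1 (real_complex R)) uZ mulN1r.
have un x : `|u x| <= nm x.
  by rewrite ler_norml nu andbT lerNl -uN -[nm x]nmN nu.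
pose i : R[i] := Complex 0 1.
have ii : i * i = -1 by rewrite -expr2 sqr_i.
have cmi : cm i = 1 by rewrite /cm normc_def/= expr0n/= add0r expr1n sqrtr1.
(* The usual complexification of a real functional; its real part is [u], and it vanishes on [D]
   because [D] is stable under [i]. *)
pose f (x : V) : R[i]^o := (u x)%:C - i * (u (i *: x))%:C.
have lf : linear f.
  move=> a x y.
  have aE w : a *: w = (complex.Re a)%:C *: w + (complex.Im a)%:C *: (i *: w).
    by rewrite [a in LHS]complexE scalerDl scalerA [i * _]mulrC.
  have u1 w : u (a *: w) = complex.Re a * u w + complex.Im a * u (i *: w).
    by rewrite aE uD !uZ.
  have u2 : u (i *: (a *: x)) = complex.Re a * u (i *: x) - complex.Im a * u x.
    by rewrite scalerA mulrC -scalerA u1 scalerA ii scaleN1r uN mulrN.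
  rewrite /f scalerDr !uD u1 u2 -[a *: (_ - _)]/(a * (_ - _)) [a in RHS]complexE.
  rewrite !rmorphD !rmorphN !rmorphM/= -/i; ring: ii.
have [F FE] : exists F : dual V, forall x, F x = f x.
  apply: (clin_of_bounded (c := 2)) => // x.
  rewrite nm_cm (le_trans (cmB _ _))// cmM cmi mul1r !cm_real.
  have := un x; have := un (i *: x); rewrite nmZ cmi mul1r; lra.
exists F; split=> [y Dy|].
  rewrite FE /f !(uG _ 0) ?rmorph0 ?mulr0 ?subr0//.
    by exists (i *: y), 0; rewrite rmorph0 scale0r addr0 mul0r; split=> //; exact: DZ.
  by exists y, 0; rewrite rmorph0 scale0r addr0 mul0r.
rewrite FE /f (uG v d); last first.
  by exists 0, 1; rewrite rmorph1 scale1r add0r mul1r.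
apply/eqP => /(congr1 (@complex.Re R)) /= H; lra.
Qed.

End Separation.

(** * Dense subspaces and limits in the dual *)

Section Dual.
Variables (R : realType) (X : normedModType R[i]).

Lemma dual_nm (f : dual X) x : cm (f x) <= nm f * nm x.
Proof. exact: (@clin_nm R X R[i]^o). Qed.

Lemma dual_nm_le (f : dual X) (c : R) : 0 <= c ->
  (forall x, cm (f x) <= c * nm x) -> nm f <= c.
Proof. exact: (@nm_clin_le R X R[i]^o). Qed.

(** Otherwise a nonzero functional on the dual kills [D]; by reflexivity it is evaluation at some
    [x], and [x] is then annihilated by [D]. *)
Lemma subspace_dense (D : set (dual X)) : reflexive_space X ->
  subspace_set D -> (forall x : X, (forall k, D k -> k x = 0) -> x = 0) ->
  dense D.
Proof.
move=> refl sD annD; apply/dense_nmP => v e e0; apply: contrapT => nD.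
have [y Dy|F [FD Fv]] := hahn_banach_separation (v := v) sD e0.
  by rewrite leNgt; apply/negP => ye; apply: nD; exists y.
have [x Fx] := refl F.
have x0 : x = 0 by apply: annD => k Dk; rewrite -Fx FD.
by move: Fv; rewrite Fx x0 linear0 eqxx.
Qed.

(** The intervals of centre [a k] and radius [r k] meet pairwise, so the supremum of their left ends
    lies in all of them. *)
Lemma real_cauchy_limit (a r : nat -> R) :
  (forall k m, (k <= m)%N -> `|a m - a k| <= r k) ->
  exists l, forall k, `|l - a k| <= r k.
Proof.
move=> ar.
have ub k j : a k - r k <= a j + r j.
  have := ar k (maxn k j) (leq_maxl _ _); have := ar j (maxn k j) (leq_maxr _ _).
  by rewrite !ler_norml => /andP[? ?] /andP[? ?]; lra.
pose A := [set a k - r k | k in [set: nat]].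
have A0 : A !=set0 by exists (a 0%N - r 0%N), 0%N.
have Aub j : ubound A (a j + r j) by move=> _ [k _ <-].
exists (sup A) => k; rewrite ler_norml; apply/andP; split.
  have : a k - r k <= sup A by apply: ub_le_sup; [exists (a 0%N + r 0%N)|exists k].
  by lra.
have : sup A <= a k + r k by exact: ge_sup.
by lra.
Qed.

(** Completeness of the dual with an explicit rate, through pointwise limits. The factor 2 comes
    from treating real and imaginary parts separately. *)
Lemma dual_cauchy_limit (F : nat -> dual X) (r : nat -> R) :
  (forall k m, (k <= m)%N -> nm (F m - F k) <= r k) ->
  (forall e, 0 < e -> exists k, r k < e) ->
  exists f : dual X, forall k, nm (f - F k) <= 2 * r k.
Proof.
move=> Fr r0.
have r_ge0 k : 0 <= r k by apply: le_trans (Fr k k (leqnn k)); exact: nm_ge0.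
have Frx k m x : (k <= m)%N -> cm (F m x - F k x) <= r k * nm x.
  move=> km; apply: le_trans (dual_nm (F m - F k) x) _.
  by rewrite ler_wpM2r ?nm_ge0// Fr.
have [f fF] : exists f : X -> R[i]^o, forall x k, cm (f x - F k x) <= 2 * r k * nm x.
  suff /choice[f fF] : forall x, exists l : R[i], forall k, cm (l - F k x) <= 2 * r k * nm x.
    by exists f.
  move=> x.
  have [k m /(Frx _ _ x)|l1 H1] := @real_cauchy_limit
      (fun k => complex.Re (F k x)) (fun k => r k * nm x).
    by apply: le_trans; rewrite -raddfB; exact: cm_Re.
  have [k m /(Frx _ _ x)|l2 H2] := @real_cauchy_limit
      (fun k => complex.Im (F k x)) (fun k => r k * nm x).
    by apply: le_trans; rewrite -raddfB; exact: cm_Im.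
  exists (l1 +i* l2) => k; rewrite (le_trans (cm_ReIm _))//.
  have -> : (l1 +i* l2 : R[i]) - F k x =
      (l1 - complex.Re (F k x)) +i* (l2 - complex.Im (F k x)) by case: (F k x).
  have := H1 k; have := H2 k; rewrite /=; lra.
have lf : linear f.
  move=> a x y; apply/eqP; rewrite -subr_eq0 -cm_eq0 eq_le cm_ge0 andbT.
  pose c := 2 * nm (a *: x + y) + cm a * (2 * nm x) + 2 * nm y.
  have c0 : 0 <= c by rewrite !addr_ge0 ?mulr_ge0 ?nm_ge0 ?cm_ge0.
  apply/ler_addgt0Pr => e e0; rewrite add0r.
  have [k rk] : exists k, r k < e / (c + 1) by apply: r0; rewrite divr_gt0// ltr_wpDl.
  move: rk; rewrite ltr_pdivlMr ?ltr_wpDl// => rk.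
  have := fF x k; have := fF y k; have := fF (a *: x + y) k => h1 h2 h3.
  have -> : f (a *: x + y) - (a *: f x + f y) =
    (f (a *: x + y) - F k (a *: x + y)) - a * (f x - F k x) - (f y - F k y).
    have Fk : F k (a *: x + y) = a * F k x + F k y by exact: clin_linear.
    by rewrite Fk -[a *: f x]/(a * f x); ring.
  rewrite (le_trans (cmB _ _))// (le_trans (lerD (cmB _ _) (lexx _)))// cmM.
  have h4 : cm a * cm (f x - F k x) <= cm a * (2 * r k * nm x).
    by rewrite ler_wpM2l ?cm_ge0.
  have := r_ge0 k; move: rk h1 h2 h4; rewrite /c; lra.
have [g gE] : exists g : dual X, forall x, g x = f x.
  apply: (clin_of_bounded (c := nm (F 0%N) + 2 * r 0%N)) => // x.
  rewrite nm_cm -[f x](subrK (F 0%N x)) (le_trans (cmD _ _))// mulrDl addrC.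
  by rewrite lerD// dual_nm.
exists g => k; apply: dual_nm_le => [|x]; first by rewrite mulr_ge0.
have -> : (g - F k) x = g x - F k x by [].
by rewrite gE.
Qed.

End Dual.

(** * Linear dynamics *)

Section Dynamics.
Variables (R : realType) (V : normedModType R[i]) (T : V -> V).
Hypothesis linT : linear T.

Lemma iter_linear n (a : R[i]) x y :
  iter n T (a *: x + y) = a *: iter n T x + iter n T y.
Proof. by elim: n => //= n ->; rewrite linT. Qed.

Lemma iter_linear0 n : iter n T 0 = 0.
Proof.
by have := iter_linear n (-1) 0 0; rewrite !scaleN1r !addNr.
Qed.

Lemma iter_linearD n x y : iter n T (x + y) = iter n T x + iter n T y.
Proof. by rewrite -[x]scale1r iter_linear !scale1r. Qed.

Definition null_seq (s : nat -> V) : Prop :=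
  forall e : R, 0 < e -> exists N, forall n, (N <= n)%N -> nm (s n) < e.

Lemma null_seq_lin (a : R[i]) s t : null_seq s -> null_seq t ->
  null_seq (fun n => a *: s n + t n).
Proof.
move=> s0 t0 e e0.
have ca : 0 < cm a + 1 by rewrite ltr_wpDl ?cm_ge0.
have [|N HN] := s0 (e / 2 / (cm a + 1)); first by rewrite !divr_gt0.
have [|M HM] := t0 (e / 2); first by rewrite divr_gt0.
exists (maxn N M) => n; rewrite geq_max => /andP[/HN {}HN /HM {}HM].
rewrite (le_lt_trans (nmD _ _))// nmZ.
have := nm_ge0 (s n); have := cm_ge0 a.
by move: HN; rewrite ltr_pdivlMr//; nra.
Qed.

Lemma null_seq0 : null_seq (fun=> 0).
Proof. by move=> e e0; exists 0%N => n _; rewrite nm0. Qed.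

Definition vanishing_orbit : set V := [set x | null_seq (fun n => iter n T x)].

(** One preimage under each iterate is chosen, with no compatibility imposed between them. *)
Definition vanishing_backward_orbit : set V :=
  [set y | exists s, null_seq s /\ forall n, iter n T (s n) = y].

Lemma subspace_vanishing_orbit : subspace_set vanishing_orbit.
Proof.
split=> [|a x y x0 y0]; rewrite /vanishing_orbit/=.
  by under eq_fun do rewrite iter_linear0; exact: null_seq0.
by under eq_fun do rewrite iter_linear; exact: null_seq_lin.
Qed.

Lemma subspace_vanishing_backward_orbit : subspace_set vanishing_backward_orbit.
Proof.
split=> [|a x y [s [s0 sx]] [t [t0 ty]]].
  by exists (fun=> 0); split; [exact: null_seq0|move=> n; exact: iter_linear0].
exists (fun n => a *: s n + t n); split; first exact: null_seq_lin.
by move=> n; rewrite iter_linear sx ty.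
Qed.

(** For large [n] the vector [x + s n] is close to [x], while its [n]-th image, the [n]-th iterate
    of [x] plus [y], is close to [y]. *)
Lemma kitai_mixing : dense vanishing_orbit -> dense vanishing_backward_orbit ->
  mixing T.
Proof.
move=> dO dB U W oU oW U0 W0.
have [x [Ux x0]] := dO U U0 oU.
have [y [Wy [s [s0 sy]]]] := dB W W0 oW.
have [d d0 dU] := open_nmP oU Ux; have [e e0 eW] := open_nmP oW Wy.
have [N HN] := s0 d d0; have [M HM] := x0 e e0.
exists (maxn N M) => n; rewrite geq_max => /andP[/HN {}HN /HM {}HM].
exists (iter n T (x + s n)); split.
  by exists (x + s n) => //; apply: dU; rewrite addrAC subrr add0r.
by rewrite iter_linearD sy; apply: eW; rewrite addrK.
Qed.

Lemma iter_periodic n m x : iter n T x = x -> iter (m * n) T x = x.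
Proof. by move=> nx; elim: m => // m IH; rewrite mulSn iterD IH. Qed.

Lemma subspace_periodic : subspace_set [set y | periodic_point T y].
Proof.
split=> [|a x y [n [n0 nx]] [m [m0 my]]] /=.
  by exists 1%N; split=> //; exact: (iter_linear0 1).
exists (m * n)%N; rewrite muln_gt0 n0 m0; split=> //.
by rewrite iter_linear iter_periodic// mulnC iter_periodic.
Qed.

End Dynamics.

(** * Norm obstructions to transitivity and hypercyclicity *)

Section NonDynamics.
Variables (R : realType) (V : normedModType R[i]) (T : V -> V).
Hypothesis V_nz : exists x : V, x != 0.

Lemma exists_nm_gt (r : R) : exists x : V, r < nm x.
Proof.
have [x x0] := V_nz; have nx : 0 < nm x by rewrite nm_gt0.
exists (((`|r| + 1) / nm x)%:C *: x); rewrite nmZ cm_real.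
rewrite ger0_norm ?divr_ge0 ?nm_ge0 ?addr_ge0// divfK ?gt_eqF//.
by rewrite (le_lt_trans (ler_norm r))// ltrDl.
Qed.

Lemma mixing_transitive : mixing T -> topologically_transitive T.
Proof.
move=> mT U W oU oW U0 W0; have [N HN] := mT U W oU oW U0 W0.
by exists N; exact: HN.
Qed.

Lemma iter_nonexpansive n x : (forall x, nm (T x) <= nm x) -> nm (iter n T x) <= nm x.
Proof. by move=> H; elim: n => //= n; apply: le_trans. Qed.

Lemma iter_expansive n x : (forall x, nm x <= nm (T x)) -> nm x <= nm (iter n T x).
Proof. by move=> H; elim: n => //= n /le_trans; apply. Qed.

Lemma nm_gt_open (r : R) : open [set x : V | r < nm x].
Proof.
apply: nm_open => x /= rx; exists (nm x - r); first by rewrite subr_gt0.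
by move=> y; rewrite nmC => yx; have := nm_trans y x 0; rewrite !subr0; lra.
Qed.

Lemma nm_lt_open (r : R) : open [set x : V | nm x < r].
Proof. by have := @nm_ball_open R V 0 r; under eq_fun do rewrite subr0. Qed.

Lemma nonexpansive_not_transitive : (forall x, nm (T x) <= nm x) ->
  ~ topologically_transitive T.
Proof.
move=> H tT; have [||n [_ [[x /= x1 <-] /= x2]]] :=
  tT _ _ (nm_lt_open 1) (nm_gt_open 1).
- by exists 0; rewrite /= nm0.
- exact: exists_nm_gt.
by have := iter_nonexpansive n x H; rewrite leNgt (lt_trans x1).
Qed.

Lemma expansive_not_transitive : (forall x, nm x <= nm (T x)) ->
  ~ topologically_transitive T.
Proof.
move=> H tT; have [||n [_ [[x /= x1 <-] /= x2]]] :=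
  tT _ _ (nm_gt_open 1) (nm_lt_open 1).
- exact: exists_nm_gt.
- by exists 0; rewrite /= nm0.
by have := iter_expansive n x H; rewrite leNgt (lt_trans x2).
Qed.

Lemma nonexpansive_not_hypercyclic : (forall x, nm (T x) <= nm x) -> ~ hypercyclic T.
Proof.
move=> H [x dx]; have [|y [/= xy [n _ nE]]] := dx _ _ (nm_gt_open (nm x)).
  exact: exists_nm_gt.
by have := iter_nonexpansive n x H; rewrite nE leNgt xy.
Qed.

(** The orbit of a nonzero [x] never enters the ball of radius [|x|] about 0, and the orbit of 0 is
    constant. *)
Lemma expansive_not_hypercyclic : (forall x, nm x <= nm (T x)) -> T 0 = 0 ->
  ~ hypercyclic T.
Proof.
move=> H T0 [x dx]; have [x0|x0] := eqVneq x 0.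
  have [|y [/= xy [n _ nE]]] := dx _ _ (nm_gt_open 0); first exact: exists_nm_gt.
  move: xy; rewrite -nE x0 (_ : iter n T 0 = 0) ?nm0 ?ltxx//.
  by elim: n {nE} => //= n ->.
have [|y [/= xy [n _ nE]]] := dx _ _ (nm_lt_open (nm x)).
  by exists 0; rewrite /= nm0 nm_gt0.
by have := iter_expansive n x H; rewrite nE leNgt xy.
Qed.

End NonDynamics.

(* The Baire theorem of the library is restricted to normed modules over a
   [realType], hence the direct nested ball construction below. *)
Section Birkhoff.
Variables (R : realType) (X : normedModType R[i]) (T : dual X -> dual X) (L : R).
Hypothesis L0 : 0 <= L.
Hypothesis TL : forall x y, nm (T x - T y) <= L * nm (x - y).

Lemma iter_lipschitz n x y : nm (iter n T x - iter n T y) <= L ^+ n * nm (x - y).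
Proof.
elim: n => [|n IH]; first by rewrite mul1r.
by rewrite /= (le_trans (TL _ _))// exprS -mulrA ler_wpM2l.
Qed.

(** Transitivity moves a point near [y] to a point near [w], and the Lipschitz bound extends this to
    a ball. Its radius is [2 * r'] because [dual_cauchy_limit] locates the limit only up to that
    factor. *)
Lemma birkhoff_step (y w : dual X) (r e : R) : topologically_transitive T ->
  0 < r -> 0 < e -> exists y' (r' : R), [/\ 0 < r', r' <= e,
    nm (y' - y) + r' <= r &
    exists n, forall u, nm (u - y') <= 2 * r' -> nm (iter n T u - w) < e].
Proof.
move=> tT r0 e0.
have r2 : 0 < r / 2 by rewrite divr_gt0.
have e2 : 0 < e / 2 by rewrite divr_gt0.
have [||n [_ [[x /= xy <-] /= Tx]]] :=
  tT _ _ (nm_ball_open y (r / 2)) (nm_ball_open w (e / 2)).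
- by exists y; rewrite /= subrr nm0.
- by exists w; rewrite /= subrr nm0.
have Ln : 0 < L ^+ n + 1 by rewrite ltr_wpDl// exprn_ge0.
pose r' := Num.min (Num.min (r / 2) e) (e / 4 / (L ^+ n + 1)).
have r'0 : 0 < r' by rewrite !lt_min r2 e0 !divr_gt0.
have : r' <= r' by []; rewrite {2}/r' !le_min => /andP[/andP[r'r r'e] r'L].
exists x, r'; split=> //; first by lra.
exists n => u ux; rewrite (le_lt_trans (nm_trans (iter n T x) _ _))//.
have := iter_lipschitz n u x; have : L ^+ n * nm (u - x) <= L ^+ n * (2 * r').
  by rewrite ler_wpM2l// exprn_ge0.
by move: r'L; rewrite ler_pdivlMr//; lra.
Qed.

Lemma birkhoff_hypercyclic (v : nat -> dual X) : dense (range v) ->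
  topologically_transitive T -> hypercyclic T.
Proof.
move=> dv tT.
(* Step [k] encodes a pair: the index of a target in the dense sequence and a precision. Every
   target thus recurs with arbitrarily small tolerance. *)
pose dec k : nat * nat := odflt (0, 0)%N (unpickle k).
have pickleE p : dec (pickle p) = p by rewrite /dec pickleK.
pose w k : dual X := v (dec k).1.
pose e (k : nat) : R := (dec k).2.+1%:R^-1.
have e_small ep : 0 < ep -> forall j, exists k, w k = v j /\ e k < ep.
  move=> ep0 j; exists (pickle (j, Num.bound ep^-1)); rewrite /w /e pickleE; split=> //.
  rewrite invf_plt ?posrE//.
  by rewrite (lt_trans (archi_boundP _)) ?invr_ge0 ?(ltW ep0)// ltr_nat.
have e0 k : 0 < e k by rewrite invr_gt0.
pose P (k : nat) (p q : dual X * R) := [/\ 0 < q.2, q.2 <= e k,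
    nm (q.1 - p.1) + q.2 <= p.2 &
    exists n, forall u, nm (u - q.1) <= 2 * q.2 -> nm (iter n T u - w k) < e k].
have [g gP] : exists g : nat * (dual X * R) -> dual X * R,
    forall kp, 0 < kp.2.2 -> P kp.1 kp.2 (g kp).
  suff /choice[g gP] : forall kp : nat * (dual X * R), exists q,
      0 < kp.2.2 -> P kp.1 kp.2 q by exists g.
  move=> [k [y r]] /=.
  (* The value at a nonpositive radius is a dummy that makes the choice function total. *)
  have [r0|r0] := pselect (0 < r); last by exists (0, 0).
  have [y' [r' [h1 h2 h3 h4]]] := birkhoff_step y (w k) tT r0 (e0 k).
  by exists (y', r').
pose s := fix s n := if n is k.+1 then g (k, s k) else ((0 : dual X), (1 : R)).
have s0 k : 0 < (s k).2.
  by elim: k => [|k IH] //=; have [] := gP (k, s k) IH.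
have sP k : P k (s k) (s k.+1) by exact: gP (k, s k) (s0 k).
have snest k m : nm ((s (k + m)%N).1 - (s k).1) + (s (k + m)%N).2 <= (s k).2.
  elim: m => [|m IH]; first by rewrite addn0 subrr nm0 add0r.
  rewrite addnS; have [_ _ H _] := sP (k + m)%N.
  rewrite (le_trans _ IH)// (le_trans (lerD (nm_trans (s (k + m)%N).1 _ _) (lexx _)))//.
  by rewrite addrAC [leRHS]addrC lerD2r.
have [k m km|ep ep0|f fs] := @dual_cauchy_limit R X (fun k => (s k).1) (fun k => (s k).2).
- have := snest k (m - k)%N; rewrite subnKC//; apply: le_trans.
  by rewrite lerDl ltW.
- have [k [_ ek]] := e_small ep ep0 0%N; exists k.+1.
  by have [_ H _ _] := sP k; exact: le_lt_trans ek.
exists f; apply/dense_nmP => x ep ep0.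
have ep2 : 0 < ep / 2 by rewrite divr_gt0.
have [_ [j _ <-] vj] := (dense_nmP _).1 dv x _ ep2.
have [k [wk ek]] := e_small _ ep2 j.
have [_ _ _ [n /(_ f (fs _)) Hn]] := sP k.
exists (iter n T f); first by exists n.
rewrite (le_lt_trans (nm_trans (v j) _ _))// [ltRHS]splitr ltrD// -wk.
exact: lt_trans Hn ek.
Qed.

End Birkhoff.

(** * Adjoints of multiplication operators *)

Lemma geometric_lt (R : realType) (q c e : R) : 0 <= q -> q < 1 -> 0 <= c -> 0 < e ->
  exists N, forall n, (N <= n)%N -> q ^+ n * c < e.
Proof.
move=> q0 q1 c0 e0; have c1 : 0 < c + 1 by rewrite ltr_wpDl.
have /cvgrPdist_lt/(_ (e / (c + 1))) : GRing.exp q @ \oo --> (0 : R).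
  by apply: cvg_expr; rewrite ger0_norm.
rewrite divr_gt0// => /(_ isT)[N _ HN]; exists N => n /HN /=.
rewrite sub0r normrN ger0_norm ?exprn_ge0// ltr_pdivlMr//.
by have := exprn_ge0 n q0; nra.
Qed.

Section MultiplicationOperators.
Variables (R : realType) (Omega : set R[i]^o) (X : completeNormedModType R[i]).
Variables (ev : X -> R[i]^o -> R[i]^o).
Hypothesis hOmega_open : open Omega.
Hypothesis hOmega_conn : connected Omega.
Hypothesis hX : banach_space_of_analytic_functions Omega ev.
Hypothesis hX_refl : reflexive_space X.
Hypothesis hX_eval : forall z, Omega z -> continuous (fun f : X => ev f z).

Lemma ev0 z : Omega z -> ev 0 z = 0.
Proof.
move=> Oz; have := ev_linear hX (-1) 0 0 Oz.
by rewrite scaler0 addr0 mulN1r addNr.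
Qed.

Lemma evaluation_functionals : exists kappa : R[i] -> dual X,
  forall z, Omega z -> forall f, kappa z f = ev f z.
Proof.
suff /choice[k kE] : forall z : R[i], exists k : dual X,
    Omega z -> forall f, k f = ev f z by exists k.
move=> z; have [Oz|] := pselect (Omega z); last by exists 0.
have H : (ev^~ z : X -> R[i]^o) \in @clin_pred R X R[i]^o.
  apply/asboolP; split; last exact: hX_eval.
  by move=> a f g; rewrite (ev_linear hX).
by exists (Clin H).
Qed.

Definition clusters_at (z : R[i]) (A : set R[i]) : Prop :=
  forall e : R, 0 < e -> exists h : R[i],
    [/\ h != 0, cm h < e, Omega (z + h) & A (z + h)].

Lemma clustering_zeros f z : Omega z ->
  clusters_at z [set w | ev f w = 0] -> f = 0.
Proof.
move=> Oz Az; have fO := ev_analytic hX f.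
have fz : ev f z = 0.
  apply/eqP; rewrite -cm_eq0 eq_le cm_ge0 andbT; apply/ler_addgt0Pr => e e0.
  have [d d0 Hd] := analytic_continuous fO Oz e0.
  have [h [_ /Hd H _ /= fh]] := Az d d0.
  by move: H; rewrite fh sub0r cmN add0r => /ltW.
have [|/power_near_isolated[r r0 H]] := analytic_local fO Oz.
  rewrite fz => f0; apply: (ev_injective hX) => w Ow.
  by rewrite ev0// (identity_theorem hOmega_open hOmega_conn fO Oz f0 Ow).
have [h [h0 hr _ /= fh]] := Az r r0.
by have := H h h0 hr; rewrite fh fz eqxx.
Qed.

Lemma clustering_dense (kappa : R[i] -> dual X) (A : set R[i])
    (D : set (dual X)) z :
  (forall w, Omega w -> forall f, kappa w f = ev f w) ->
  Omega z -> clusters_at z A -> subspace_set D ->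
  (forall w, Omega w -> A w -> D (kappa w)) -> dense D.
Proof.
move=> kE Oz Az sD AD; apply: (subspace_dense hX_refl sD) => f fD.
apply: (clustering_zeros Oz) => e /Az[h [h0 he Oh Ah]].
by exists h; split=> //=; rewrite -kE//; apply: fD; exact: AD.
Qed.

Definition ratC (q : rat * rat) : R[i] := ratr q.1 +i* ratr q.2.

Lemma ratC_near (z : R[i]) (e : R) : 0 < e ->
  exists q, ratC q != z /\ cm (ratC q - z) < e.
Proof.
case: z => x y e0.
have [|p] := @rat_in_itvoo R x (x + e / 2); first by rewrite ltrDl divr_gt0.
rewrite in_itv/= => /andP[p1 p2].
have [|q] := @rat_in_itvoo R y (y + e / 2); first by rewrite ltrDl divr_gt0.
rewrite in_itv/= => /andP[q1 q2].
(* The real part is strictly larger than [x], so the point differs from [z], as clustering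
   demands. *)
exists (p, q); split; first by rewrite eq_complex/= gt_eqF.
rewrite (le_lt_trans (cm_ReIm _))//= !gtr0_norm ?subr_gt0//; lra.
Qed.

Lemma ratC_clusters_at z : Omega z -> clusters_at z (range ratC).
Proof.
move=> Oz e e0; have [d d0 HO] := open_nmP hOmega_open Oz.
have ed : 0 < Num.min e d by rewrite lt_min e0.
have [q [qz]] := ratC_near z ed.
rewrite lt_min => /andP[qe qd]; exists (ratC q - z).
by rewrite subrKC; split=> //; [rewrite subr_eq0|exact: HO].
Qed.

(** Combinations, with complex rational coefficients, of evaluations at complex rational points are
    countable. Values of [kappa] at rational points off [Omega] merely add further vectors. *)
Lemma dual_separable (kappa : R[i] -> dual X) z :
  (forall w, Omega w -> forall f, kappa w f = ev f w) -> Omega z ->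
  exists v : nat -> dual X, dense (range v).
Proof.
move=> kE Oz.
pose comb (s : seq ((rat * rat) * (rat * rat))) : dual X :=
  \sum_(p <- s) ratC p.1 *: kappa (ratC p.2).
pose v n := if unpickle n is Some s then comb s else 0.
have vE s : v (pickle s) = comb s by rewrite /v pickleK.
(* The closure of the countable set of combinations; it is shown to be a complex subspace so that
   [clustering_dense] applies. *)
pose D : set (dual X) := [set x | forall e : R, 0 < e -> exists s, nm (comb s - x) < e].
have DD x y : D x -> D y -> D (x + y).
  move=> Dx Dy e e0; have e2 : 0 < e / 2 by rewrite divr_gt0.
  have [s sx] := Dx _ e2; have [t ty] := Dy _ e2; exists (s ++ t).
  rewrite /comb big_cat/= -/(comb s) -/(comb t) opprD addrACA.
  by rewrite (le_lt_trans (nmD _ _))// [ltRHS]splitr ltrD.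
have D0 : D 0 by move=> e e0; exists [::]; rewrite /comb big_nil subrr nm0.
have Dk (a : R[i]) q : D (a *: kappa (ratC q)).
  move=> e e0.
  have ek : 0 < e / (nm (kappa (ratC q)) + 1).
    by rewrite divr_gt0// ltr_wpDl// nm_ge0.
  have [c [_ ca]] := ratC_near a ek.
  exists [:: (c, q)]; rewrite /comb big_seq1 -scalerBl nmZ.
  move: ca; rewrite ltr_pdivlMr ?ltr_wpDl ?nm_ge0//.
  have := cm_ge0 (ratC c - a); rewrite /=; nra.
have Dc (a : R[i]) s : D (a *: comb s).
  rewrite /comb; elim: s => [|p s IH]; first by rewrite big_nil scaler0.
  by rewrite big_cons scalerDr scalerA; apply: DD.
have DZ (a : R[i]) x : D x -> D (a *: x).
  move=> Dx e e0; have ca : 0 < cm a + 1 by rewrite ltr_wpDl ?cm_ge0.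
  have [|s sx] := Dx (e / 2 / (cm a + 1)); first by rewrite !divr_gt0.
  have [|t ts] := Dc a s (e / 2); first by rewrite divr_gt0.
  exists t; rewrite (le_lt_trans (nm_trans (a *: comb s) _ _))//.
  rewrite -scalerBr nmZ; move: sx; rewrite ltr_pdivlMr//.
  have := nm_ge0 (comb s - x); have := cm_ge0 a; nra.
have dD : dense D.
  apply: (clustering_dense kE Oz (ratC_clusters_at Oz)).
    split; first exact: D0.
    by move=> a x y Dx Dy; exact: DD (DZ a x Dx) Dy.
  by move=> _ _ [q _ <-]; have := Dk 1 q; rewrite scale1r.
exists v; apply/dense_nmP => x e e0; have e2 : 0 < e / 2 by rewrite divr_gt0.
have [y Dy yx] := (dense_nmP D).1 dD x _ e2; have [s sy] := Dy _ e2.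
exists (comb s); first by exists (pickle s).
by rewrite (le_lt_trans (nm_trans y _ _))// [ltRHS]splitr ltrD.
Qed.

Variables (phi : R[i]^o -> R[i]^o) (Mphi : clin X X).
Hypothesis hphi : analytic_on Omega phi.
Hypothesis hMphi : is_multiplication_operator Omega ev phi Mphi.

Local Notation T := (adjoint Mphi).

(** * Dynamics of the adjoint when the symbol takes a unimodular value *)

Section Unimodular.
Variable kappa : R[i] -> dual X.
Hypothesis kappaE : forall w, Omega w -> forall f, kappa w f = ev f w.

Lemma iter_adjoint_evaluation n z : Omega z ->
  iter n T (kappa z) = (phi z ^+ n : R[i]) *: kappa z.
Proof.
have TZ (a : R[i]) y : T (a *: y) = a *: T y by exact: clin_ext.
move=> Oz; elim: n => [|n IH]; first by rewrite expr0 scale1r.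
rewrite iterS IH TZ exprSr -scalerA; congr (_ *: _); apply: clin_ext => f.
have AE k x : T k x = k (Mphi x) by [].
have ZE (a : R[i]) (k : dual X) x : (a *: k) x = a * k x by [].
by rewrite AE ZE !kappaE// hMphi.
Qed.

Variable z : R[i].
Hypothesis Oz : Omega z.
Hypothesis phiz : cm (phi z) = 1.
Hypothesis hphi_nonconst : ~ exists c, forall z, Omega z -> phi z = c.

Let pz : power_near phi z.
Proof. exact: nonconstant_power_near Oz. Qed.

Let linT : linear T.
Proof. exact: clin_linear. Qed.

(** Moving the value in the direction [- phi z] gives modulus at most [(1 - t) + t / 2]. *)
Lemma clusters_at_lt1 : clusters_at z [set w | cm (phi w) < 1].
Proof.
move=> e e0; have [d d0 HO] := open_nmP hOmega_open Oz.
have n0 : - phi z != 0 by rewrite -cm_gt0 cmN phiz.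
have ed : 0 < Num.min e d by rewrite lt_min e0.
have [h [t [+ t0 t1 H]]] := power_near_direction pz n0 ed.
rewrite lt_min => /andP[he hd].
have p1 : cm (phi (z + h)) < 1.
  have -> : phi (z + h) = (phi (z + h) - phi z - t%:C * - phi z) + (1 - t)%:C * phi z.
    by rewrite rmorphB rmorph1; ring.
  rewrite (le_lt_trans (cmD _ _))// cmM cm_real gtr0_norm ?subr_gt0//.
  by move: H; rewrite cmN phiz; lra.
exists h; split=> //; last by apply: HO; rewrite addrC addKr.
by apply: contraTneq p1 => ->; rewrite addr0 phiz ltxx.
Qed.

(** Moving the value in the direction [phi z] gives modulus at least [(1 + t) - t / 2]. *)
Lemma clusters_at_gt1 : clusters_at z [set w | 1 < cm (phi w)].
Proof.
move=> e e0; have [d d0 HO] := open_nmP hOmega_open Oz.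
have n0 : phi z != 0 by rewrite -cm_gt0 phiz.
have ed : 0 < Num.min e d by rewrite lt_min e0.
have [h [t [+ t0 t1 H]]] := power_near_direction pz n0 ed.
rewrite lt_min => /andP[he hd].
have p1 : 1 < cm (phi (z + h)).
  have : cm ((1 + t)%:C * phi z) <=
      cm (phi (z + h)) + cm (phi (z + h) - phi z - t%:C * phi z).
    have -> : (1 + t)%:C * phi z = phi (z + h) - (phi (z + h) - phi z - t%:C * phi z).
      by rewrite rmorphD rmorph1; ring.
    exact: cmB.
  by rewrite cmM cm_real gtr0_norm ?addr_gt0// phiz; move: H; rewrite phiz; lra.
exists h; split=> //; last by apply: HO; rewrite addrC addKr.
by apply: contraTneq p1 => ->; rewrite addr0 phiz ltxx.
Qed.

Lemma clusters_at_root_of_unity :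
  clusters_at z [set w | exists2 n, (0 < n)%N & phi w ^+ n = 1].
Proof.
move=> e e0.
have [d d0 Hd] := open_mapping hOmega_open hOmega_conn hphi hphi_nonconst Oz e0.
have [w [n [n0 wn wz wd]]] := roots_of_unity_near phiz d0.
have [h [he Oh hw]] := Hd w wd; exists h; split=> //.
  by apply: contraNneq wz => h0; rewrite -hw h0 addr0.
by exists n; rewrite // hw.
Qed.

Lemma adjoint_mixing : mixing T.
Proof.
apply: (kitai_mixing linT).
  apply: (clustering_dense kappaE Oz clusters_at_lt1).
    exact: subspace_vanishing_orbit.
  move=> w Ow /= w1 e e0; have [N HN] :=
    geometric_lt (cm_ge0 _) w1 (nm_ge0 (kappa w)) e0.
  by exists N => n /HN; rewrite iter_adjoint_evaluation// nmZ cmX.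
apply: (clustering_dense kappaE Oz clusters_at_gt1).
  exact: subspace_vanishing_backward_orbit.
(* Dividing the eigenvector by the [n]-th power of its eigenvalue gives a preimage under the [n]-th
   iterate. *)
move=> w Ow /= w1; exists (fun n => (phi w ^- n : R[i]) *: kappa w).
have w0 : phi w != 0 by rewrite -cm_gt0 (lt_trans ltr01).
split=> [e e0|n].
  have q0 : 0 <= (cm (phi w))^-1 by rewrite invr_ge0 cm_ge0.
  have q1 : (cm (phi w))^-1 < 1 by rewrite invf_lt1// (lt_trans ltr01).
  have [N HN] := geometric_lt q0 q1 (nm_ge0 (kappa w)) e0.
  by exists N => n /HN; rewrite nmZ cmV cmX exprVn.
have := iter_linear linT n (phi w ^- n) (kappa w) 0.
rewrite iter_linear0// !addr0 => ->.
by rewrite iter_adjoint_evaluation// scalerA mulVf ?scale1r// expf_neq0.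
Qed.

Lemma adjoint_chaotic : chaotic T.
Proof.
split; first exact: mixing_transitive adjoint_mixing.
apply: (clustering_dense kappaE Oz clusters_at_root_of_unity).
  exact: subspace_periodic.
move=> w Ow [n n0 wn]; exists n; split=> //.
by rewrite iter_adjoint_evaluation// wn scale1r.
Qed.

Lemma adjoint_hypercyclic : hypercyclic T.
Proof.
have [v dv] := dual_separable kappaE Oz.
apply: (birkhoff_hypercyclic (nm_ge0 T)) dv _.
  move=> x y; have -> : T x - T y = T (x - y) by exact: clin_ext.
  exact: clin_nm.
exact: mixing_transitive adjoint_mixing.
Qed.

End Unimodular.

(** * The adjoint when the symbol omits the unit circle *)

Hypothesis hX_mult : forall psi : R[i]^o -> R[i]^o, bounded_analytic_on Omega psi ->
  exists M : clin X X, is_multiplication_operator Omega ev psi M /\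
    `|M| <= supnorm Omega psi.
Hypothesis hOmega0 : Omega !=set0.

Lemma contractive_multiplication (psi : R[i]^o -> R[i]^o) :
  analytic_on Omega psi -> (forall w, Omega w -> cm (psi w) <= 1) ->
  exists2 M : clin X X, is_multiplication_operator Omega ev psi M &
    forall x, nm (M x) <= nm x.
Proof.
move=> aO psi1; have [|M [MM Mle]] := hX_mult (psi := psi).
  split=> //; exists 1; split; first exact: real1.
  move=> x x1 w Ow /=; rewrite (le_trans _ (ltW x1))//.
  by rewrite -(rmorph1 (real_complex R)) nm_le psi1.
exists M => // x; rewrite (le_trans (clin_nm M x))// ler_piMl ?nm_ge0//.
move: Mle; rewrite /supnorm nm_le => /le_trans; apply.
apply: ge_sup; first by have [w Ow] := hOmega0; exists (complex.Re `|psi w|), w.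
by move=> _ [w Ow <-]; exact: psi1.
Qed.

Lemma adjoint_contractive_or_expansive :
  (phi @` Omega) `&` [set z | `|z| = 1] = set0 ->
  (forall y, nm (T y) <= nm y) \/ (forall y, nm y <= nm (T y)).
Proof.
move=> phi1.
have n1 w : Omega w -> cm (phi w) != 1.
  move=> Ow; apply/eqP => w1; suff : (@set0 R[i]) (phi w) by [].
  by rewrite -[set0]phi1; split; [exists w|rewrite /= cmE w1].
have op (P : R -> Prop) :
    (forall r, P r -> exists2 e : R, 0 < e & forall s, `|s - r| < e -> P s) ->
    open (Omega `&` [set w | P (cm (phi w))]).
  move=> Pop; apply: nm_open => w [Ow /= /Pop[e e0 He]].
  have [d d0 HO] := open_nmP hOmega_open Ow.
  have [d' d'0 Hc] := analytic_continuous hphi Ow e0.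
  exists (Num.min d d') => [|y]; first by rewrite lt_min d0.
  rewrite lt_min => /andP[yd yd']; split; [exact: HO|apply: He].
  have := Hc _ yd'; rewrite subrKC => H.
  have := cm_trans (phi w) (phi y) 0; have := cm_trans (phi y) (phi w) 0.
  rewrite !subr0 (cmC (phi w) (phi y)) ltr_norml => *; apply/andP; split; lra.
pose B := Omega `&` [set w | cm (phi w) < 1].
pose B' := Omega `&` [set w | 1 < cm (phi w)].
have oB : open B.
  apply: (op (fun r => r < 1)) => r r1; exists (1 - r); first by rewrite subr_gt0.
  by move=> s; rewrite ltr_norml; lra.
have oB' : open B'.
  apply: (op (fun r => 1 < r)) => r r1; exists (r - 1); first by rewrite subr_gt0.
  by move=> s; rewrite ltr_norml; lra.
have [[w Bw]|/set0P/negP/negPn/eqP B0] := pselect (B !=set0).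
  left; have BO : B = Omega.
    apply: hOmega_conn.
    - by exists w.
    - by exists B => //; rewrite /B setIA setIid.
    (* As no modulus equals 1, [B] is the trace on [Omega] of the closed complement of [B']. *)
    exists (~` B'); first exact: open_closedC.
    apply/seteqP; split=> [y [Oy /= y1]|y [Oy yB']]; split=> //=.
      by move=> [_ /=]; rewrite ltNge (ltW y1).
    rewrite lt_neqAle n1//= leNgt; apply/negP => y1; exact: yB'.
  have [y|M MM Mle] := contractive_multiplication hphi.
    by rewrite -BO => -[_ /ltW].
  (* The norm bound only asserts that some multiplication operator exists; injectivity of [ev]
     identifies it with [Mphi]. *)
  have ME : M = Mphi.
    by apply: clin_ext => x; apply: (ev_injective hX) => u Ou; rewrite MM// hMphi.
  move=> y; apply: dual_nm_le => [|x]; first exact: nm_ge0.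
  rewrite -[adjoint Mphi y x]/(y (Mphi x)) (le_trans (dual_nm _ _))//.
  by rewrite ler_wpM2l ?nm_ge0// -ME.
right; have gt1 w : Omega w -> 1 < cm (phi w).
  move=> Ow; rewrite ltNge; apply/negP => w1; suff : B w by rewrite B0.
  by split=> //=; rewrite lt_neqAle n1.
have phi0 w : Omega w -> phi w != 0.
  by move=> /gt1 w1; rewrite -cm_gt0 (lt_trans ltr01).
have [w Ow|M MM Mle] :=
    contractive_multiplication (analytic_on_inv hOmega_open hphi phi0).
  by rewrite cmV invf_le1 ?ltW ?gt1// (lt_trans ltr01) ?gt1.
move=> y; apply: dual_nm_le => [|x]; first exact: nm_ge0.
(* Here [M] multiplies by [1 / phi], so [Mphi] undoes it; as [M] is a contraction, the norm of [y]
   is at most that of its image under the adjoint. *)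
have -> : y x = adjoint Mphi y (M x).
  rewrite -[RHS]/(y (Mphi (M x))); congr (y _); apply: (ev_injective hX) => w Ow.
  by rewrite hMphi// MM// mulVKf// phi0.
by rewrite (le_trans (dual_nm _ _))// ler_wpM2l ?nm_ge0.
Qed.

End MultiplicationOperators.

Theorem theorem1p1 (R : realType) (Omega : set R[i]^o)
    (X : completeNormedModType R[i]) (ev : X -> R[i]^o -> R[i]^o)
    (phi : R[i]^o -> R[i]^o) (Mphi : clin X X)
    (hOmega0 : Omega !=set0) (hOmega_open : open Omega)
    (hOmega_conn : connected Omega)
    (hX : banach_space_of_analytic_functions Omega ev)
    (hX0 : exists f : X, f != 0)
    (hX_refl : reflexive_space X)
    (hX_eval : forall z, Omega z -> continuous (fun f : X => ev f z))
    (hX_mult : forall psi : R[i]^o -> R[i]^o, bounded_analytic_on Omega psi ->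
      exists M : clin X X, is_multiplication_operator Omega ev psi M /\
        `|M| <= supnorm Omega psi)
    (hphi : bounded_analytic_on Omega phi)
    (hphi_nonconst : ~ exists c, forall z, Omega z -> phi z = c)
    (hMphi : is_multiplication_operator Omega ev phi Mphi) :
  [<-> hypercyclic (adjoint Mphi);
       mixing (adjoint Mphi);
       chaotic (adjoint Mphi);
       (phi @` Omega) `&` [set z | `|z| = 1] !=set0].
Proof.
have [kappa kE] := evaluation_functionals hX hX_eval.
(* Some evaluation is nonzero because [X] is; the norm obstructions need vectors of large norm in
   the dual. *)
have dual_nz : exists k : dual X, k != 0.
  have [f f0] := hX0; apply: contrapT => nk; case/eqP: f0.
  apply: (ev_injective hX) => z Oz; rewrite (ev0 hX Oz) -kE//.
  by have [->|k0] := eqVneq (kappa z) 0; last by case: nk; exists (kappa z).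
have T0 : adjoint Mphi 0 = 0 by exact: clin_ext.
(* Mixing and chaos enter through transitivity, so these two properties cover all three. *)
have unimodular : hypercyclic (adjoint Mphi) \/ topologically_transitive (adjoint Mphi) ->
    (phi @` Omega) `&` [set z | `|z| = 1] !=set0.
  move=> dyn; apply/set0P/eqP => phi1.
  have [T1|T1] := adjoint_contractive_or_expansive hOmega_open hOmega_conn hX
      hphi.1 hMphi hX_mult hOmega0 phi1; case: dyn.
  - exact: nonexpansive_not_hypercyclic.
  - exact: nonexpansive_not_transitive.
  - by move/(expansive_not_hypercyclic dual_nz T1); exact.
  - exact: expansive_not_transitive.
have mixing_chaotic_hypercyclic :
    (phi @` Omega) `&` [set z | `|z| = 1] !=set0 ->
    [/\ mixing (adjoint Mphi), chaotic (adjoint Mphi) & hypercyclic (adjoint Mphi)].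
  move=> [_ [[z Oz <-] /= z1]].
  have phiz : cm (phi z) = 1 by rewrite /cm z1.
  split.
  - exact: (adjoint_mixing hOmega_open hOmega_conn hX hX_refl hphi.1 hMphi kE Oz).
  - exact: (adjoint_chaotic hOmega_open hOmega_conn hX hX_refl hphi.1 hMphi kE Oz).
  - exact: (adjoint_hypercyclic hOmega_open hOmega_conn hX hX_refl hphi.1 hMphi kE Oz).
(* Every implication of the cycle goes through the unimodular value, which yields the three
   dynamical properties together. *)
tfae.
- by move=> hT; case: (mixing_chaotic_hypercyclic (unimodular (or_introl hT))).
- move=> /mixing_transitive mT.
  by case: (mixing_chaotic_hypercyclic (unimodular (or_intror mT))).
- by move=> [tT _]; apply: unimodular; right.
- by case/mixing_chaotic_hypercyclic.
Qed.
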